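(* Let $\epsilon>0$ and let $(k_n)_{n\in\mathbb{N}}$ be a sequence of nonnegative integers such that $k_n/n<1-\epsilon$ for all $n\in\mathbb{N}$ and $\lim_{n\to\infty}k_n=\infty$. For each $n$ with $k_n\ge 1$ (hence for all sufficiently large $n$) put $\kappa_n=k_n/n$ and let $y_n\in(0,\infty)$ be the unique solution of $$-\frac{F'(y_n)}{F(y_n)}=\frac{1}{\kappa_n}.$$ Then, as $n\to\infty$, $$\frac{k_n!\,A(2,n,k_n)}{n!}\ \sim\ \frac{e^{k_n\ln(F(y_n))+n y_n}}{\sqrt{2\pi k_n\left(\frac{F''(y_n)}{F(y_n)}-\left(\frac{F'(y_n)}{F(y_n)}\right)^2\right)}}.$$
   Context: Here $a_n\sim b_n$ means $a_n/b_n\to 1$. For $|q|<1$, $(q;q)_\infty=\prod_{p=1}^{\infty}(1-q^p)$. The d'Arcais numbers $A(2,n,k)$, for $n\in\{0,1,2,\dots\}$ and $k\in\{0,\dots,n\}$, are defined by the generating function $$1+\sum_{n=1}^{\infty}\sum_{k=0}^{n}\frac{A(2,n,k)}{n!}x^k z^n=\exp\left(-x\ln\big((z;z)_\infty\big)\right).$$ Equivalently, $\frac{k!\,A(2,n,k)}{n!}$ is the coefficient of $z^n$ in the power series $\big(-\ln((z;z)_\infty)\big)^k$, where $-\ln((z;z)_\infty)=\sum_{m\ge1}\frac{\sigma(m)}{m}z^m$ and $\sigma(m)=\sum_{d\mid m}d$. The function $F:(0,\infty)\to(0,\infty)$ is $F(y)=-\ln\big((e^{-y};e^{-y})_\infty\big)=\sum_{m=1}^\infty\frac{\sigma(m)}{m}e^{-my}$.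 The map $y\mapsto -F'(y)/F(y)$ is a bijection from $(0,\infty)$ onto $(1,\infty)$, so $y_n$ is well defined. *)

(* Defs.v *)
From HB Require Import structures.
From mathcomp Require Import all_boot all_order all_algebra.
From mathcomp Require Import all_classical all_reals all_analysis.
Import Order.TTheory GRing.Theory Num.Theory.
Import numFieldNormedType.Exports.

Set Implicit Arguments.
Unset Strict Implicit.
Unset Printing Implicit Defensive.

Local Open Scope classical_set_scope.
Local Open Scope ring_scope.

(* (q;q)_oo, meaningful for `|q| < 1. *)
Definition qpoch (R : realType) (q : R) : R :=
  limn (fun N : nat => \prod_(1 <= p < N.+1) (1 - q ^+ p)).

(* [A n k] stands for A(2,n,k).  The generating function is read as an identity
   of convergent series on the real unit disc, where (z;z)_oo > 0; it determines
   [A n k] for all n >= 1 and k <= n, and other values of [A] are not used. *)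
Definition is_dArcais2 (R : realType) (A : nat -> nat -> R) : Prop :=
  forall x z : R, `|z| < 1 ->
    1 + \sum_(1 <= n < N.+1) \sum_(0 <= k < n.+1)
          A n k / n`!%:R * x ^+ k * z ^+ n
      @[N --> \oo] --> expR (- x * ln (qpoch z)).

(* Meaningful for y > 0. *)
Definition F (R : realType) (y : R) : R := - ln (qpoch (expR (- y))).

Definition asymp_equiv (R : realType) (a b : nat -> R) : Prop :=
  a n / b n @[n --> \oo] --> (1 : R).

(* Main.v *)
Require Import Defs.
From HB Require Import structures.
From mathcomp Require Import all_boot all_order all_algebra.
From mathcomp Require Import all_classical all_reals all_analysis.
From mathcomp Require Import measurable_realfun complex ring lra.
Import Order.TTheory GRing.Theory Num.Theory.
Import numFieldNormedType.Exports.
Import ComplexField.Normc.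

Set Implicit Arguments.
Unset Strict Implicit.
Unset Printing Implicit Defensive.

Local Open Scope classical_set_scope.
Local Open Scope ring_scope.

(* With L(z) = -ln (z;z)_oo = \sum_m (sigma(m)/m) z^m, the quantity k! A(2,n,k) / n! is the
   coefficient of z^n in L^k, hence F(y)^k e^(n y) P(S_k = n), where S_k is a sum of k
   independent copies of a variable X with P(X = m) = (sigma(m)/m) e^(-m y) / F(y).  The choice
   y = y_n makes E(S_k) = n, so the claim is a local limit theorem, uniform for y in (0, Y]
   because k/n < 1 - eps bounds y_n.  It is proved by Fourier inversion for X truncated at M,
   with M huge depending on n.  The delicate point is that n may be enormous compared with k,
   so that y -> 0 arbitrarily fast: away from 0 the characteristic function phi satisfies
   |phi| <= q < 1 (since sigma(m)/m >= 1, X has a geometric component of weight >= 1/2), and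
   the integral of |phi|^k <= q^(k-2) |phi|^2 there is controlled by Parseval together with
   P(X = X') = O(y), X' an independent copy. *)

(** * Characteristic functions of polynomials *)

(** All estimates are scale free. For [y <= Y] the moments of y X are bounded and its variance stays
    away from 0, with constants depending on Y only, so the third moment in units of the standard
    deviation is bounded however fast y -> 0. The lower bound for the variance needs no computation
    with sigma(m): it is read off from the decay of phi at one point t <= y. Truncation makes every
    law a polynomial, so that inversion and Parseval are finite orthogonality relations.
    Coefficients of degree n <= M do not feel it, hence M can be chosen after y, n and k, with
    moment defects below k^(-2) that survive the k-th power. The bound P(X = X') = O(y) cannot be
    pointwise, since sigma(m)/m is unbounded; it rests on the mean square of sigma(m)/m being
    bounded. Bounding y_n matters because X degenerates to the constant 1 as y -> oo: E(X) - 1 is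
    then O(e^(-y)), while k/n < 1 - eps keeps it above a positive constant. *)

Section complex_exponential.
Variable R : realType.
Implicit Types (x y t u : R) (z w : R[i]) (n : nat).

Definition cis x : R[i] := Complex (cos x) (sin x).

Lemma cisD x y : cis (x + y) = cis x * cis y.
Proof.
apply/eqP; rewrite eq_complex /= cosD sinD; apply/andP; split; apply/eqP => //.
by rewrite addrC.
Qed.

Lemma cis0 : cis 0 = 1.
Proof. by rewrite /cis cos0 sin0. Qed.

Lemma cisMn n x : cis (n%:R * x) = cis x ^+ n.
Proof.
elim: n => [|n IHn]; first by rewrite mul0r cis0.
by rewrite exprS -IHn -cisD -nat1r mulrDl mul1r.
Qed.

Lemma normc_cis x : normc (cis x) = 1.
Proof. by rewrite /= cos2Dsin2 sqrtr1. Qed.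

Lemma normc_real x : normc (x%:C)%C = `|x|.
Proof. by rewrite /= expr0n addr0 sqrtr_sqr. Qed.

Lemma normcX z n : normc (z ^+ n) = normc z ^+ n.
Proof. by elim: n => [|n IHn]; rewrite ?normc1// !exprS normcM IHn. Qed.

Lemma normc_ge0 z : 0 <= normc z.
Proof. by case: z => a b; exact: sqrtr_ge0. Qed.

Lemma normc_sum (I : Type) (r : seq I) (P : pred I) (f : I -> R[i]) :
  normc (\sum_(i <- r | P i) f i) <= \sum_(i <- r | P i) normc (f i).
Proof.
elim/big_rec2: _ => [|i y z _ IH]; first by rewrite normc0.
by rewrite (le_trans (le_normcD _ _))// lerD2l.
Qed.

Lemma normc_le_ReIm z : normc z <= `|complex.Re z| + `|complex.Im z|.
Proof.
case: z => a b /=; rewrite -[leRHS]ger0_norm ?addr_ge0// -sqrtr_sqr ler_sqrt ?sqr_ge0//.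
rewrite sqrrD !real_normK ?num_real// lerD2r lerDl.
by rewrite mulrn_wge0// mulr_ge0.
Qed.

Lemma Re_le_normc z : `|complex.Re z| <= normc z.
Proof.
case: z => a b /=; rewrite -sqrtr_sqr ler_sqrt ?lerDl ?sqr_ge0//.
by rewrite addr_ge0 ?sqr_ge0.
Qed.

Lemma normc_sqr z : normc z ^+ 2 = complex.Re z ^+ 2 + complex.Im z ^+ 2.
Proof. by case: z => a b /=; rewrite sqr_sqrtr// addr_ge0 ?sqr_ge0. Qed.

Lemma Re_sum (I : Type) (r : seq I) (P : pred I) (f : I -> R[i]) :
  complex.Re (\sum_(i <- r | P i) f i) = \sum_(i <- r | P i) complex.Re (f i).
Proof. by apply: (big_morph (@complex.Re R)) => [[a b] [c d]|]. Qed.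

Lemma Im_sum (I : Type) (r : seq I) (P : pred I) (f : I -> R[i]) :
  complex.Im (\sum_(i <- r | P i) f i) = \sum_(i <- r | P i) complex.Im (f i).
Proof. by apply: (big_morph (@complex.Im R)) => [[a b] [c d]|]. Qed.

Lemma Re_realM x z : complex.Re (x%:C * z)%C = x * complex.Re z.
Proof. by case: z => a b /=; rewrite mul0r subr0. Qed.

Lemma Im_realM x z : complex.Im (x%:C * z)%C = x * complex.Im z.
Proof. by case: z => a b /=; rewrite mul0r addr0. Qed.

(** By telescoping. Applied with exponent k, it turns an O(k^(-3/2)) error for one characteristic
    function into O(k^(-1/2)) for its k-th power. *)
Lemma normc_subX z w n : normc z <= 1 -> normc w <= 1 ->
  normc (z ^+ n - w ^+ n) <= n%:R * normc (z - w).
Proof.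
move=> z1 w1; elim: n => [|n IHn]; first by rewrite subrr normc0 mul0r.
have -> : z ^+ n.+1 - w ^+ n.+1 = z * (z ^+ n - w ^+ n) + (z - w) * w ^+ n.
  by rewrite !exprS; ring.
rewrite (le_trans (le_normcD _ _))// !normcM normcX -nat1r mulrDl mul1r addrC.
apply: lerD.
  by rewrite ler_piMr ?normc_ge0// exprn_ile1 ?normc_ge0.
by rewrite (le_trans _ IHn)// ler_piMl ?normc_ge0.
Qed.

End complex_exponential.

(** * Elementary Taylor bounds *)

Section taylor.
Variable R : realType.
Implicit Types (x : R).

(** The mean value theorem. The bounds below are obtained in a chain: the derivative of each
    difference is a difference already known to be nonnegative. *)
Lemma ge0_of_derive (f f' : R -> R) : (forall x, is_derive x 1 f (f' x)) ->
  (forall x, 0 <= x -> 0 <= f' x) -> 0 <= f 0 ->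
  forall x, 0 <= x -> 0 <= f x.
Proof.
move=> df f'0 f0 x x0.
have [|c /itvP cx] := @MVT_segment R f f' 0 x x0 (fun y _ => df y).
  by apply: derivable_within_continuous => y _; exact: ex_derive.
move/eqP; rewrite subr_eq => /eqP ->.
by rewrite addr_ge0// subr0 mulr_ge0// f'0// cx.
Qed.

Lemma sin_le x : 0 <= x -> sin x <= x.
Proof.
move=> x0; rewrite -subr_ge0; move: x x0.
apply: (@ge0_of_derive _ (fun x => 1 - cos x)).
- by move=> x _; rewrite subr_ge0 cos_le1.
- by rewrite sin0 subrr.
Qed.

Lemma cos_ge_quad x : 1 - x ^+ 2 / 2 <= cos x.
Proof.
wlog x0 : x / 0 <= x => [H|].
  by case: (leP 0 x) => [/H//|/ltW x0]; rewrite -cosN -sqrrN H// oppr_ge0.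
rewrite -subr_ge0; move: x x0.
apply: (@ge0_of_derive _ (fun x => x - sin x)).
- move=> x; apply: is_derive_eq.
  by rewrite /GRing.scale/=; field.
- by move=> x x0; rewrite subr_ge0 sin_le.
- by rewrite cos0; lra.
Qed.

Lemma sin_ge_cubic x : 0 <= x -> x - x ^+ 3 / 6 <= sin x.
Proof.
move=> x0; rewrite -subr_ge0; move: x x0.
apply: (@ge0_of_derive _ (fun x => cos x - (1 - x ^+ 2 / 2))).
- move=> x; apply: is_derive_eq.
  by rewrite /GRing.scale/=; field.
- by move=> x x0; rewrite subr_ge0 cos_ge_quad.
- by rewrite sin0; lra.
Qed.

Lemma sin_ge_quad x : 0 <= x -> x - x ^+ 2 / 2 <= sin x.
Proof.
have cosge (y : R) : 0 <= y -> 0 <= cos y - 1 + y.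
  have df (z : R) : is_derive z 1 (fun x => cos x - 1 + x) (1 - sin z).
    by apply: is_derive_eq; rewrite /GRing.scale/=; ring.
  apply: (ge0_of_derive df).
  - by move=> z _; rewrite subr_ge0 sin_le1.
  - by rewrite cos0; lra.
have df (z : R) : is_derive z 1 (fun x => sin x - (x - x ^+ 2 / 2)) (cos z - 1 + z).
  by apply: is_derive_eq; rewrite /GRing.scale/=; field.
move=> x0; rewrite -subr_ge0; move: x x0; apply: (ge0_of_derive df) => //.
by rewrite sin0; lra.
Qed.

Lemma cos_le_cubic x : 0 <= x -> cos x <= 1 - x ^+ 2 / 2 + x ^+ 3.
Proof.
move=> x0; rewrite -subr_ge0; move: x x0.
apply: (@ge0_of_derive _ (fun x => sin x - x + 3 * x ^+ 2)).
- by move=> x; apply: is_derive_eq; rewrite /GRing.scale/=; field.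
- by move=> x x0; have := sin_ge_quad x0; have := sqr_ge0 x; lra.
- by rewrite cos0; lra.
Qed.

(** A cubic remainder, cruder than the quartic one, so that the third absolute moment controls the
    real and the imaginary parts alike. *)
Lemma cos_taylor x : `|cos x - (1 - x ^+ 2 / 2)| <= `|x| ^+ 3.
Proof.
rewrite -cos_norm -(real_normK (num_real x)); have := normr_ge0 x.
move: `|x| => y y0; have := cos_le_cubic y0; have := cos_ge_quad y.
by rewrite ler_norml => *; apply/andP; split; have := exprn_ge0 3 y0; lra.
Qed.

Lemma sin_taylor x : `|sin x - x| <= `|x| ^+ 3.
Proof.
wlog x0 : x / 0 <= x => [H|].
  case: (leP 0 x) => [/H//|/ltW x0].
  have -> : sin x - x = - (sin (- x) - - x) by rewrite sinN; ring.
  by rewrite normrN -(normrN x) H// oppr_ge0.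
rewrite (ger0_norm x0); have := sin_ge_cubic x0; have := sin_le x0.
by rewrite ler_norml => *; apply/andP; split; have := exprn_ge0 3 x0; lra.
Qed.

Lemma expR_le_quad x : 0 <= x -> expR (- x) <= 1 - x + x ^+ 2 / 2.
Proof.
move=> x0; rewrite -subr_ge0; move: x x0.
apply: (@ge0_of_derive _ (fun x => expR (- x) - (1 - x))).
- by move=> x; apply: is_derive_eq; rewrite /GRing.scale/=; field.
- by move=> x _; rewrite subr_ge0 expR_ge1Dx.
- by rewrite oppr0 expR0; lra.
Qed.

End taylor.

(** * Centred characteristic functions and their expansion at 0 *)

Section charf.
Variable R : realType.
Implicit Types (p : {poly R}) (mu t : R) (n k : nat).

Definition charf p mu t : R[i] :=
  \sum_(i < size p) (p`_i)%:C%C * cis ((i%:R - mu) * t).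

Lemma charfE p mu t :
  charf p mu t = cis (- (mu * t)) * (map_poly (real_complex R) p).[cis t].
Proof.
rewrite horner_coef size_map_inj_poly//; last exact: complexI.
rewrite mulr_sumr; apply: eq_bigr => i _.
rewrite coef_map/= mulrBl cisD cisMn; ring.
Qed.

(** By [charfE], [charf] is a phase times the value of p at e^(it). Powers of p are convolutions,
    and the k centres mu add up to the integer n. *)
Lemma charfX p mu t k n : k%:R * mu = n%:R ->
  charf p mu t ^+ k = charf (p ^+ k) n%:R t.
Proof.
by move=> kmu; rewrite !charfE exprMn -cisMn rmorphXn/= horner_exp mulrN mulrA kmu.
Qed.

Lemma Re_charf p mu t :
  complex.Re (charf p mu t) = \sum_(i < size p) p`_i * cos ((i%:R - mu) * t).
Proof. by rewrite Re_sum; apply: eq_bigr => i _; rewrite Re_realM. Qed.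

Lemma Im_charf p mu t :
  complex.Im (charf p mu t) = \sum_(i < size p) p`_i * sin ((i%:R - mu) * t).
Proof. by rewrite Im_sum; apply: eq_bigr => i _; rewrite Im_realM. Qed.

Lemma normc_charf_sqr p mu t : normc (charf p mu t) ^+ 2 =
  \sum_(i < size p) \sum_(j < size p) p`_i * p`_j * cos ((i%:R - j%:R) * t).
Proof.
rewrite normc_sqr Re_charf Im_charf !expr2 !mulr_suml -big_split/=.
apply: eq_bigr => i _; rewrite !mulr_sumr -big_split/=; apply: eq_bigr => j _.
have -> : (i%:R - j%:R) * t = (i%:R - mu) * t - (j%:R - mu) * t by ring.
rewrite cosB; ring.
Qed.

Lemma normc_charf_le1 p mu t : (forall i, 0 <= p`_i) ->
  normc (charf p mu t) <= \sum_(i < size p) p`_i.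
Proof.
move=> p0; rewrite (le_trans (normc_sum _ _ _))//; apply: ler_sum => i _.
by rewrite normcM normc_real normc_cis mulr1 ger0_norm.
Qed.

(** Because of truncation the moments of order 0, 1, 2 only approximate 1, 0 and [s2]; each defect
    enters with its own power of t. The factor 2 counts the remainders of cosine and sine. *)
Lemma charf_taylor p mu t s2 : (forall i, 0 <= p`_i) ->
  normc (charf p mu t - (1 - t ^+ 2 * s2 / 2)%:C%C) <=
    `|\sum_(i < size p) p`_i - 1| + `|t| * `|\sum_(i < size p) p`_i * (i%:R - mu)|
    + t ^+ 2 / 2 * `|\sum_(i < size p) p`_i * (i%:R - mu) ^+ 2 - s2|
    + 2 * `|t| ^+ 3 * \sum_(i < size p) p`_i * `|i%:R - mu| ^+ 3.
Proof.
move=> p0; set S0 := \sum_(i < _) p`_i; set S1 := \sum_(i < _) _.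
set S2 := \sum_(i < _) _; set S3 := \sum_(i < _) _.
set z := charf p mu t - _; rewrite (le_trans (normc_le_ReIm z))//.
have -> : complex.Re z =
    \sum_(i < size p) p`_i * (cos ((i%:R - mu) * t) - (1 - ((i%:R - mu) * t) ^+ 2 / 2))
    + ((S0 - 1) - t ^+ 2 / 2 * (S2 - s2)).
  rewrite /z raddfB/= Re_charf.
  have -> : \sum_(i < size p) p`_i * (cos ((i%:R - mu) * t) -
      (1 - ((i%:R - mu) * t) ^+ 2 / 2)) =
      \sum_(i < size p) p`_i * cos ((i%:R - mu) * t) - S0 + t ^+ 2 / 2 * S2.
    by rewrite mulr_sumr -sumrB -big_split/=; apply: eq_bigr => i _; field.
  by field.
have -> : complex.Im z =
    \sum_(i < size p) p`_i * (sin ((i%:R - mu) * t) - (i%:R - mu) * t) + t * S1.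
  rewrite /z raddfB/= Im_charf subr0 mulr_sumr -big_split/=; apply: eq_bigr => i _; ring.
have tay (f : R -> R) : (forall x, `|f x| <= `|x| ^+ 3) ->
    `|\sum_(i < size p) p`_i * f ((i%:R - mu) * t)| <= `|t| ^+ 3 * S3.
  move=> fx; rewrite (le_trans (ler_norm_sum _ _ _))// mulr_sumr.
  apply: ler_sum => i _; rewrite normrM (ger0_norm (p0 _)).
  rewrite mulrCA ler_wpM2l// (le_trans (fx _))// normrM exprMn mulrC//.
have t1 := tay _ (@cos_taylor R); have t2 := tay _ (@sin_taylor R).
apply: le_trans (lerD (ler_normD _ _) (ler_normD _ _)) _.
have := ler_normB (S0 - 1) (t ^+ 2 / 2 * (S2 - s2)).
rewrite (normrM t S1) (normrM (t ^+ 2 / 2)) (ger0_norm (x := t ^+ 2 / 2)); last first.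
  by rewrite divr_ge0 ?sqr_ge0.
lra.
Qed.

End charf.

(** * Orthogonality, Fourier inversion and Parseval *)

Section trigonometric_integrals.
Variable R : realType.
Notation mu := (@lebesgue_measure R).

Lemma Rintegral_is_derive (f G : R -> R) (a b : R) : a < b ->
  (forall x : R, is_derive x 1 G (f x)) -> continuous f ->
  \int[mu]_(x in `[a, b]) f x = G b - G a.
Proof.
move=> ab dG cf; rewrite /Rintegral (@continuous_FTC2 _ f G)//.
- exact: continuous_subspaceT.
- have cG : continuous G.
    move=> x; apply: differentiable_continuous; apply/derivable1_diffP.
    exact: (@ex_derive _ _ _ _ _ _ _ (dG x)).
  split.
  + by move=> x _; exact: (@ex_derive _ _ _ _ _ _ _ (dG x)).
  + exact: cvg_at_right_filter (cG a).
  + exact: cvg_at_left_filter (cG b).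
- by move=> x _; rewrite derive1E (@derive_val _ _ _ _ _ _ _ (dG x)).
Qed.

Lemma sin_natpi (n : nat) : sin (n%:R * pi) = 0 :> R.
Proof.
elim: n => [|n IHn]; first by rewrite mul0r sin0.
by rewrite -nat1r mulrDl mul1r addrC sinDpi IHn oppr0.
Qed.

(** A primitive of cos((a - b) u / sigma). Equal indices are split off because the general formula
    would divide by 0 there. *)
Definition cos_primitive (a b : nat) (sigma u : R) : R :=
  if a == b then u
  else sin ((a%:R - b%:R) * (u / sigma)) * (sigma / (a%:R - b%:R)).

Lemma is_derive_cos_primitive (a b : nat) (sigma x : R) : sigma != 0 ->
  is_derive x 1 (cos_primitive a b sigma) (cos ((a%:R - b%:R) * (x / sigma))).
Proof.
move=> s0; rewrite /cos_primitive; have [->|ab] := eqVneq a b.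
  by rewrite subrr mul0r cos0; exact: is_derive_id.
apply: is_derive_eq; rewrite /GRing.scale/=; field.
by rewrite s0 subr_eq0 eqr_nat.
Qed.

Lemma cos_primitive_pi (a b : nat) (sigma : R) : sigma != 0 ->
  cos_primitive a b sigma (pi * sigma) - cos_primitive a b sigma (- (pi * sigma)) =
  if a == b then 2 * pi * sigma else 0.
Proof.
move=> s0; rewrite /cos_primitive; case: ifP => _; first by ring.
rewrite mulNr mulfK// mulrN sinN mulNr opprK.
suff -> : sin ((a%:R - b%:R) * pi) = 0 :> R by rewrite mul0r addr0.
by rewrite mulrBl sinB !sin_natpi mul0r mulr0 subrr.
Qed.

Lemma continuous_cos_sum (I : Type) (r : seq I) (c w : I -> R) (sigma : R) :
  continuous (fun u : R => \sum_(i <- r) c i * cos (w i * (u / sigma))).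
Proof.
move=> x; apply: cvg_big => [|i _]; first exact: add_continuous.
apply: cvgM; first exact: cvg_cst.
apply: continuous_comp; last exact: continuous_cos.
by apply: cvgM; [exact: cvg_cst|apply: cvgM; [exact: cvg_id|exact: cvg_cst]].
Qed.

(** Integer frequencies integrate to 0 over a full period unless they vanish. Fourier inversion is
    the case of constant [b], Parseval the case of a sum over pairs. The variable u = sigma t is the
    one in which the integrand tends to a fixed Gaussian. *)
Lemma Rintegral_cos_sum (I : Type) (r : seq I) (c : I -> R) (a b : I -> nat)
    (sigma : R) : 0 < sigma ->
  \int[mu]_(u in `[- (pi * sigma), pi * sigma])
     (\sum_(i <- r) c i * cos (((a i)%:R - (b i)%:R) * (u / sigma))) =
  2 * pi * sigma * \sum_(i <- r | a i == b i) c i.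
Proof.
move=> s0; have s0' := lt0r_neq0 s0.
pose G (u : R) := \sum_(i <- r) (c i * cos_primitive (a i) (b i) sigma u).
have dG (x : R) : is_derive x 1 G
    (\sum_(i <- r) c i * cos (((a i)%:R - (b i)%:R) * (x / sigma))).
  rewrite /G; elim: r {G} => [|i r IHr].
    rewrite big_nil; under eq_fun do rewrite big_nil.
    exact: is_derive_cst.
  rewrite big_cons; under eq_fun do rewrite big_cons.
  apply: is_deriveD.
  by apply: is_deriveZ; exact: is_derive_cos_primitive.
rewrite (Rintegral_is_derive _ dG).
- rewrite /G -sumrB mulr_sumr [RHS]big_mkcond/=; apply: eq_bigr => i _.
  by rewrite -mulrBr cos_primitive_pi//; case: ifP => _; ring.
- by rewrite -subr_gt0 opprK addr_gt0// mulr_gt0// pi_gt0.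
- exact: continuous_cos_sum.
Qed.

Lemma continuous_Re_charf p m (sigma : R) :
  continuous (fun u : R => complex.Re (charf p m (u / sigma))).
Proof. by under eq_fun do rewrite Re_charf; exact: continuous_cos_sum. Qed.

Lemma normc_charf_sqr_pair p m (u sigma : R) : normc (charf p m (u / sigma)) ^+ 2 =
  \sum_(ij : 'I_(size p) * 'I_(size p))
    p`_ij.1 * p`_ij.2 * cos ((ij.1%:R - ij.2%:R) * (u / sigma)).
Proof. by rewrite normc_charf_sqr pair_big. Qed.

Lemma continuous_normc_charf_sqr p m (sigma : R) :
  continuous (fun u : R => normc (charf p m (u / sigma)) ^+ 2).
Proof.
under eq_fun do rewrite normc_charf_sqr_pair.
exact: continuous_cos_sum.
Qed.

Lemma Rintegral_charf (p : {poly R}) (n : nat) (sigma : R) : 0 < sigma ->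
  \int[mu]_(u in `[- (pi * sigma), pi * sigma]) complex.Re (charf p n%:R (u / sigma)) =
  2 * pi * sigma * p`_n.
Proof.
move=> s0; under eq_Rintegral do rewrite Re_charf.
rewrite (Rintegral_cos_sum _ _ _ (fun=> n))//; congr (_ * _).
have [np|pn] := ltnP n (size p).
  by rewrite (big_pred1 (Ordinal np)).
rewrite big1 ?nth_default// => i /eqP ni.
by move: (ltn_ord i); rewrite ni ltnNge pn.
Qed.

Lemma Rintegral_normc_charf_sqr (p : {poly R}) m (sigma : R) : 0 < sigma ->
  \int[mu]_(u in `[- (pi * sigma), pi * sigma]) (normc (charf p m (u / sigma)) ^+ 2) =
  2 * pi * sigma * \sum_(i < size p) p`_i ^+ 2.
Proof.
move=> s0; under eq_Rintegral do rewrite normc_charf_sqr_pair.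
rewrite (Rintegral_cos_sum _ _ (fun ij => val ij.1) (fun ij => val ij.2))//.
congr (_ * _); rewrite big_mkcond/=.
rewrite -(pair_bigA _ (fun i j : 'I_(size p) => if val i == val j then p`_i * p`_j else 0))/=.
apply: eq_bigr => i _; rewrite -big_mkcond/= (big_pred1 i) ?expr2//.
Qed.

End trigonometric_integrals.

(** * A local limit theorem *)

Section local_limit.
Variable R : realType.
Notation mu := (@lebesgue_measure R).

Lemma normal_pdf01E : normal_pdf 0 1 =
  (fun u : R => (Num.sqrt (2 * pi))^-1 * expR (- (u ^+ 2 / 2))).
Proof.
apply/funext => u; rewrite normal_pdfE ?oner_neq0// /normal_peak /normal_fun.
by congr (_^-1 * expR _); [congr (Num.sqrt _); ring|field].
Qed.

Lemma gauss_integrable : mu.-integrable setT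
  (EFin \o (fun u : R => expR (- (u ^+ 2 / 4)))).
Proof.
have s2 : Num.sqrt 2 != 0 :> R by rewrite gt_eqF// sqrtr_gt0.
have ig := integrableZl measurableT (normal_peak (Num.sqrt 2))^-1
  (integrable_normal_pdf 0 (Num.sqrt 2 : R)).
apply: eq_integrable ig => // u _; rewrite /= -EFinM normal_pdfE//.
rewrite mulKf ?gt_eqF ?normal_peak_gt0// /normal_fun subr0 sqr_sqrtr//.
by congr (expR _)%:E; field.
Qed.

Lemma expR_ge_sqr (x : R) : 0 <= x -> x ^+ 2 / 2 <= expR x.
Proof. by move=> /(expR_ge1Dxn 1); rewrite (_ : 2`! = 2%N)//; lra. Qed.

Lemma cvg_geometric_sqrt (q : R) (k : nat -> nat) : 0 <= q < 1 ->
  k n @[n --> \oo] --> \oo ->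
  q ^+ (k n - 2) * Num.sqrt (k n)%:R @[n --> \oo] --> (0 : R).
Proof.
move=> /andP[q0 q1] koo.
(* [q] may be 0, so it is replaced by a ratio with a finite logarithm. *)
pose r := Num.max q (1 / 2); have r0 : 0 < r by rewrite lt_max; apply/orP; right; lra.
have r1 : r < 1 by rewrite gt_max q1/=; lra.
pose d := - ln r; have d0 : 0 < d by rewrite oppr_gt0 ln_lt0// r0.
have rE (n : nat) : r ^+ n = expR (- (n%:R * d)).
  by rewrite mulrN opprK expRM_natl lnK.
have koor : (k n)%:R @[n --> \oo] --> (+oo : set_system R) by apply/cvgrnyP.
have kV : ((k n)%:R)^-1 @[n --> \oo] --> (0 : R).
  apply/gtr0_cvgV0 => //; near=> n; rewrite ltr0n.
  by near: n; move/cvgnyPge: koo; apply.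
apply: (@squeeze_cvgr _ _ _ _ (fun=> 0) (fun n => (2 / d ^+ 2 / r ^+ 2) * ((k n)%:R)^-1)).
- near=> n.
  have k2 : (2 <= k n)%N by near: n; move/cvgnyPge: koo; apply.
  have kn0 : 0 < (k n)%:R :> R by rewrite ltr0n (leq_trans _ k2).
  rewrite mulr_ge0 ?exprn_ge0//=.
  have qr : q ^+ (k n - 2) <= r ^+ (k n) / r ^+ 2.
    rewrite ler_pdivlMr ?exprn_gt0// -[in leRHS](subnK k2) exprD.
    apply: ler_wpM2r; first exact/exprn_ge0/ltW.
    by rewrite lerXn2r ?nnegrE ?(ltW r0)// le_max lexx.
  (* From e^x >= x^2/2 at x = k d: r^k is at most 2/(k d)^2, which absorbs sqrt k <= k. *)
  have key : r ^+ k n * Num.sqrt (k n)%:R <= 2 / d ^+ 2 * (k n)%:R^-1.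
    rewrite rE expRN ler_pdivrMl ?expR_gt0//.
    have := @expR_ge_sqr ((k n)%:R * d) (mulr_ge0 (ltW kn0) (ltW d0)).
    have sk : Num.sqrt (k n)%:R <= (k n)%:R :> R.
      rewrite -[leRHS](sqr_sqrtr (ltW kn0)) expr2 ler_peMr ?sqrtr_ge0// -[leLHS]sqrtr1.
      by rewrite ler_sqrt// ler1n (leq_trans _ k2).
    move=> H; apply: (le_trans sk).
    have kE : (k n)%:R = ((k n)%:R * d) ^+ 2 / 2 * (2 / d ^+ 2 * (k n)%:R^-1) :> R.
      by field; rewrite !lt0r_neq0.
    rewrite [leLHS]kE; apply: ler_wpM2r => //.
    by rewrite mulr_ge0 ?invr_ge0 ?(ltW kn0)// divr_ge0// exprn_ge0// ltW.
  apply: (le_trans (ler_wpM2r (sqrtr_ge0 _) qr)).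
  rewrite mulrAC [leRHS]mulrAC; apply: ler_wpM2r => //.
  by rewrite invr_ge0 exprn_ge0// ltW.
- exact: cvg_cst.
- by rewrite -[X in _ --> X](mulr0 (2 / d ^+ 2 / r ^+ 2)); apply: cvgM => //; exact: cvg_cst.
Unshelve. all: by end_near. Qed.

(** This is [charf_taylor] at t = v/s with all moments measured in units of s. The result no longer
    involves s, whence uniformity in the scale. *)
Lemma charf_le_gauss (p : {poly R}) (m s C : R) (k : nat) (u v : R) :
  v = u / Num.sqrt k%:R ->
  (0 < k)%N -> 0 < s -> 0 <= C ->
  (forall i, 0 <= p`_i) ->
  `|\sum_(i < size p) p`_i - 1| <= (k%:R ^+ 2)^-1 ->
  `|\sum_(i < size p) p`_i * (i%:R - m)| <= s * (k%:R ^+ 2)^-1 ->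
  `|\sum_(i < size p) p`_i * (i%:R - m) ^+ 2 - s ^+ 2| <= s ^+ 2 * (k%:R ^+ 2)^-1 ->
  \sum_(i < size p) p`_i * `|i%:R - m| ^+ 3 <= C * s ^+ 3 ->
  normc (charf p m (u / (s * Num.sqrt k%:R)) - (1 - v ^+ 2 / 2)%:C%C) <=
    (k%:R ^+ 2)^-1 * (1 + `|v| + v ^+ 2 / 2) + 2 * C * `|v| ^+ 3.
Proof.
move=> vE k0 s0 C0 p0 h0 h1 h2 h3.
have -> : u / (s * Num.sqrt k%:R) = v / s by rewrite vE invfM mulrA mulrAC.
have -> : 1 - v ^+ 2 / 2 = 1 - (v / s) ^+ 2 * s ^+ 2 / 2.
  by field; rewrite lt0r_neq0.
rewrite (le_trans (charf_taylor _ _ _ p0))//.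
rewrite mulrDr mulrDr mulr1.
have vs : `|v / s| = `|v| / s by rewrite normrM normfV (gtr0_norm s0).
apply: lerD; first apply: lerD; first apply: lerD => //.
- rewrite vs; have vs0 : 0 <= `|v| / s by rewrite divr_ge0// ltW.
  apply: (le_trans (ler_wpM2l vs0 h1)).
  rewrite le_eqVlt; apply/orP; left; apply/eqP; field.
  by rewrite !lt0r_neq0// ltr0n.
- have vs0 : 0 <= (v / s) ^+ 2 / 2 by rewrite divr_ge0// sqr_ge0.
  apply: (le_trans (ler_wpM2l vs0 h2)).
  rewrite le_eqVlt; apply/orP; left; apply/eqP; field.
  by rewrite !lt0r_neq0// ltr0n.
- have vs0 : 0 <= 2 * `|v / s| ^+ 3 by rewrite mulr_ge0// exprn_ge0.
  apply: (le_trans (ler_wpM2l vs0 h3)).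
  rewrite le_eqVlt; apply/orP; left; apply/eqP; rewrite vs; field.
  by rewrite lt0r_neq0.
Qed.

(** The dominating function. With |v| <= rho, the condition [8 * C * rho <= 1] makes the cubic error
    at most v^2/4, so |phi| <= 1 - v^2/4 + 3/k^2. Bounding by an exponential and raising to the
    power k leaves the factor e^(3/k) <= e^3. *)
Lemma charf_central (p : {poly R}) (m s C rho : R) (k : nat) (u : R) :
  (0 < k)%N -> 0 < s -> 0 <= C ->
  (forall i, 0 <= p`_i) ->
  `|\sum_(i < size p) p`_i - 1| <= (k%:R ^+ 2)^-1 ->
  `|\sum_(i < size p) p`_i * (i%:R - m)| <= s * (k%:R ^+ 2)^-1 ->
  `|\sum_(i < size p) p`_i * (i%:R - m) ^+ 2 - s ^+ 2| <= s ^+ 2 * (k%:R ^+ 2)^-1 ->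
  \sum_(i < size p) p`_i * `|i%:R - m| ^+ 3 <= C * s ^+ 3 ->
  rho <= 1 -> 8 * C * rho <= 1 -> `|u| <= rho * Num.sqrt k%:R ->
  normc (charf p m (u / (s * Num.sqrt k%:R))) ^+ k <= expR 3 * expR (- (u ^+ 2 / 4)).
Proof.
move=> k0 s0 C0 p0 h0 h1 h2 h3 rho1 Crho urho.
set v := u / Num.sqrt k%:R.
have := charf_le_gauss (erefl v) k0 s0 C0 p0 h0 h1 h2 h3.
set z := charf _ _ _ => zv.
have k0' : 0 < k%:R :> R by rewrite ltr0n.
have k1' : 1 <= k%:R :> R by rewrite ler1n.
have sk0 : 0 < Num.sqrt k%:R :> R by rewrite sqrtr_gt0.
have vrho : `|v| <= rho by rewrite normrM normfV (gtr0_norm sk0) ler_pdivrMr.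
have v1 : `|v| <= 1 by rewrite (le_trans vrho).
have v2E : v ^+ 2 = u ^+ 2 / k%:R by rewrite exprMn exprVn sqr_sqrtr// ltW.
have v21 : v ^+ 2 <= 1 by rewrite -real_normK ?num_real// exprn_ile1.
have v3 : 2 * C * `|v| ^+ 3 <= v ^+ 2 / 4.
  rewrite exprS -[in leRHS](real_normK (num_real v)) mulrA [leRHS]mulrC.
  by apply: ler_wpM2r; rewrite ?exprn_ge0//; have := ler_wpM2l C0 vrho; lra.
have kV0 : 0 < (k%:R ^+ 2)^-1 :> R by rewrite invr_gt0 exprn_gt0.
have kv : (k%:R ^+ 2)^-1 * (1 + `|v| + v ^+ 2 / 2) <= 3 * (k%:R ^+ 2)^-1.
  by rewrite [leRHS]mulrC ler_wpM2l ?ltW//; lra.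
have z1 : normc z <= 1 - v ^+ 2 / 4 + 3 * (k%:R ^+ 2)^-1.
  have := le_normcD (z - (1 - v ^+ 2 / 2)%:C%C) ((1 - v ^+ 2 / 2)%:C%C).
  rewrite subrK normc_real ger0_norm; last by lra.
  by lra.
have z2 : normc z <= expR (- (v ^+ 2 / 4) + 3 * (k%:R ^+ 2)^-1).
  by rewrite (le_trans z1)// (le_trans _ (expR_ge1Dx _))//; lra.
rewrite (le_trans (lerXn2r _ _ _ z2)) ?nnegrE ?normc_ge0 ?expR_ge0//.
rewrite -expRM_natl -expRD ler_expR v2E.
have -> : k%:R * (- (u ^+ 2 / k%:R / 4) + 3 * (k%:R ^+ 2)^-1) =
   3 / k%:R - u ^+ 2 / 4 :> R by field; rewrite lt0r_neq0.
by rewrite lerD2r ler_pdivrMr//; lra.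
Qed.

(** The one-step error is O(k^(-3/2)) at v = u / sqrt k, and exp(-u^2/2) is the k-th power of
    exp(-v^2/2), so [normc_subX] applies. The numerator depends on u and C only, which gives
    convergence along sequences of varying laws. *)
Lemma charf_pointwise (p : {poly R}) (m s C : R) (k : nat) (u : R) :
  (0 < k)%N -> 0 < s -> 0 <= C ->
  (forall i, 0 <= p`_i) -> \sum_(i < size p) p`_i <= 1 ->
  `|\sum_(i < size p) p`_i - 1| <= (k%:R ^+ 2)^-1 ->
  `|\sum_(i < size p) p`_i * (i%:R - m)| <= s * (k%:R ^+ 2)^-1 ->
  `|\sum_(i < size p) p`_i * (i%:R - m) ^+ 2 - s ^+ 2| <= s ^+ 2 * (k%:R ^+ 2)^-1 ->
  \sum_(i < size p) p`_i * `|i%:R - m| ^+ 3 <= C * s ^+ 3 ->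
  normc (charf p m (u / (s * Num.sqrt k%:R)) ^+ k - (expR (- (u ^+ 2 / 2)))%:C%C) <=
  (1 + `|u| + u ^+ 2 + 2 * C * `|u| ^+ 3 + u ^+ 4) / Num.sqrt k%:R.
Proof.
move=> k0 s0 C0 p0 p1 h0 h1 h2 h3.
have k0' : 0 < k%:R :> R by rewrite ltr0n.
have sk0 : 0 < Num.sqrt k%:R :> R by rewrite sqrtr_gt0.
have := charf_le_gauss (erefl (u / Num.sqrt k%:R)) k0 s0 C0 p0 h0 h1 h2 h3.
have := normc_charf_le1 m (u / (s * Num.sqrt k%:R)) p0.
set r := Num.sqrt k%:R in sk0 *; set z := charf _ _ _; set v := u / r => z1 zv.
have kE : k%:R = r ^+ 2 by rewrite sqr_sqrtr// ltW.
have r1 : 1 <= r by rewrite -[leLHS]sqrtr1 ler_sqrt// ler1n.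
have vE : u = v * r by rewrite divfK// lt0r_neq0.
clearbody v.
have -> : expR (- (u ^+ 2 / 2)) = expR (- (v ^+ 2 / 2)) ^+ k.
  by rewrite -expRM_natl kE vE; congr expR; ring.
rewrite rmorphXn/=.
set w := expR _; have w1 : w <= 1.
  by rewrite -[leRHS]expR0 ler_expR oppr_le0 divr_ge0// sqr_ge0.
have w2 : `|1 - v ^+ 2 / 2 - w| <= v ^+ 4 / 8.
  have := expR_le_quad (x := v ^+ 2 / 2); rewrite -/w divr_ge0 ?sqr_ge0// => /(_ erefl).
  have := expR_ge1Dx (- (v ^+ 2 / 2)); rewrite -/w.
  have -> : (v ^+ 2 / 2) ^+ 2 / 2 = v ^+ 4 / 8 by field.
  have := exprn_even_ge0 v (n := 4) erefl.
  by rewrite ler_norml => *; apply/andP; split; lra.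
rewrite (le_trans (normc_subX _ _ _))//.
- exact: le_trans p1.
- by rewrite normc_real ger0_norm ?expR_ge0.
rewrite kE ler_pdivlMr//.
have zw : normc (z - w%:C%C) <= (k%:R ^+ 2)^-1 * (1 + `|v| + v ^+ 2 / 2)
    + 2 * C * `|v| ^+ 3 + v ^+ 4 / 8.
  have -> : z - w%:C%C = (z - (1 - v ^+ 2 / 2)%:C%C) + (1 - v ^+ 2 / 2 - w)%:C%C.
    by rewrite rmorphB/=; ring.
  by rewrite (le_trans (le_normcD _ _))// normc_real; lra.
rewrite mulrAC -exprSr; apply: (le_trans (ler_wpM2l (exprn_ge0 3 (ltW sk0)) zw)).
have -> : `|u| = `|v| * r by rewrite vE normrM (gtr0_norm sk0).
rewrite kE; set V := `|v|; have V2 : v ^+ 2 = V ^+ 2 by rewrite real_normK ?num_real.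
have V4 : v ^+ 4 = V ^+ 4 by rewrite (exprM v 2 2) V2 -exprM.
rewrite vE !exprMn V2 V4; have V0 : 0 <= V by exact: normr_ge0.
have r0' : 0 < r by [].
have -> : r ^+ 3 * (((r ^+ 2) ^+ 2)^-1 * (1 + V + V ^+ 2 / 2) + 2 * C * V ^+ 3 + V ^+ 4 / 8)
  = r^-1 * (1 + V + V ^+ 2 / 2) + 2 * C * (V ^+ 3 * r ^+ 3) + V ^+ 4 * r ^+ 3 / 8.
  by field; rewrite lt0r_neq0.
have e1 : r^-1 * (1 + V + V ^+ 2 / 2) <= 1 + V * r + V ^+ 2 * r ^+ 2.
  apply: (@le_trans _ _ (1 * (1 + V + V ^+ 2 / 2))).
    by rewrite ler_wpM2r ?addr_ge0 ?divr_ge0 ?exprn_ge0// invf_le1.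
  rewrite mul1r; have := ler_peMr V0 r1; have := ler_peMr (exprn_ge0 2 V0) (exprn_ege1 2 r1).
  by have := exprn_ge0 2 V0; lra.
have e2 : V ^+ 4 * r ^+ 3 / 8 <= V ^+ 4 * r ^+ 4.
  have := ler_wpM2l (exprn_ge0 4 V0) (ler_weXn2l r1 (leqnSn 3)).
  have := mulr_ge0 (exprn_ge0 4 V0) (exprn_ge0 3 (ltW r0')).
  by lra.
exact: lerD (lerD e1 (lexx _)) e2.
Qed.

Lemma measurable_within (f : R -> R) (a b : R) : continuous f ->
  measurable_fun setT (fun x => f x * \1_`[a, b] x).
Proof.
move=> cf; apply: measurable_funM; first exact: continuous_measurable_fun.
exact: measurable_indic.
Qed.

(** Dominated convergence for the integrands extended by 0 outside the growing intervals. *)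
Lemma cvg_gauss_integral (f : nat -> R -> R) (a : nat -> R) (M : R) :
  (forall n, continuous (f n)) ->
  a n @[n --> \oo] --> +oo ->
  (forall u, f n u @[n --> \oo] --> expR (- (u ^+ 2 / 2))) ->
  (forall n u, `|u| <= a n -> `|f n u| <= M * expR (- (u ^+ 2 / 4))) ->
  \int[mu]_(u in `[- a n, a n]) f n u @[n --> \oo] --> Num.sqrt (2 * pi).
Proof.
move=> cf aoo flim fM.
(* Needed where the extended integrand is 0; it is forced by the bound at u = 0. *)
have M0 : 0 <= M.
  have [n an] : exists n, 0 <= a n.
    by have /cvgryPge/(_ 0) [n _ /(_ n (leqnn n))] := aoo; exists n.
  have := fM n 0; rewrite normr0 expr0n mul0r oppr0 expR0 mulr1 => /(_ an).
  by apply: le_trans.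
have sq0 : Num.sqrt (2 * pi) != 0 :> R by rewrite gt_eqF// sqrtr_gt0 mulr_gt0// pi_gt0.
have intN : (\int[mu]_x (expR (- (x ^+ 2 / 2)))%:E = (Num.sqrt (2 * pi))%:E)%E.
  have -> : (fun x : R => (expR (- (x ^+ 2 / 2)))%:E) =
      (fun x => (Num.sqrt (2 * pi))%:E * (normal_pdf 0 1 x)%:E)%E.
    by apply/funext => x; rewrite normal_pdf01E -EFinM mulVKf.
  by rewrite integralZl ?integral_normal_pdf ?mule1//; exact: integrable_normal_pdf.
have lim u : f n u * \1_`[- a n, a n] u @[n --> \oo] --> expR (- (u ^+ 2 / 2)).
  apply: cvg_trans (flim u); apply: near_eq_cvg; near=> n.
  rewrite indicE mem_set ?mulr1//= in_itv/= -ler_norml.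
  by near: n; move/cvgryPge: aoo; apply.
have [|||||_ _ H] := @dominated_convergence _ _ _ mu setT measurableT
  (fun n u => (f n u * \1_`[- a n, a n] u)%:E) (fun u => (expR (- (u ^+ 2 / 2)))%:E)
  (fun u => (M * expR (- (u ^+ 2 / 4)))%:E).
- by move=> n; apply/measurable_EFinP; exact: measurable_within.
- apply/measurable_EFinP; apply: continuous_measurable_fun => u.
  apply: continuous_comp; last exact: continuous_expR.
  apply: cvgN; apply: cvgM; last exact: cvg_cst.
  exact: exprn_continuous.
- by apply: aeW => u _; apply/fine_cvgP; split; [exact: nearW|exact: lim].
- exact: integrableZl gauss_integrable.
- apply: aeW => u n _; rewrite /= lee_fin normrM indicE.
  have [/set_mem|_] := boolP (u \in _).
    by rewrite /= in_itv/= -ler_norml normr1 mulr1 => /fM.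
  by rewrite normr0 mulr0 mulr_ge0// expR_ge0.
rewrite intN in H.
have -> : (fun n => \int[mu]_(u in `[- a n, a n]) f n u) =
    (fun n => fine (\int[mu]_x (f n x * \1_`[- a n, a n] x)%:E)).
  apply/funext => n; rewrite /= Rintegral_mkcond /Rintegral; congr fine.
  by apply: eq_integral => x _; rewrite patch_indic.
exact: fine_cvg H.
Unshelve. all: by end_near. Qed.

Lemma cvg_of_dist_le (f e : nat -> R) (l : R) : (forall n, `|f n - l| <= e n) ->
  e n @[n --> \oo] --> 0 -> f n @[n --> \oo] --> l.
Proof.
move=> fe e0; apply: (@squeeze_cvgr _ _ _ _ (fun n => l - e n) (fun n => l + e n)).
- by apply: nearW => n; have := fe n; rewrite ler_distl.
- by rewrite -[X in _ --> X]subr0; apply: cvgB => //; exact: cvg_cst.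
- by rewrite -[X in _ --> X]addr0; apply: cvgD => //; exact: cvg_cst.
Qed.

Lemma Rintegral_restrict_le (f g : R -> R) (a b : R) : continuous f -> continuous g ->
  0 <= a <= b -> (forall u, 0 <= g u) ->
  (forall u, a <= `|u| -> `|u| <= b -> `|f u| <= g u) ->
  `|\int[mu]_(u in `[- b, b]) f u - \int[mu]_(u in `[- a, a]) f u| <=
  \int[mu]_(u in `[- b, b]) g u.
Proof.
move=> cf cg /andP[a0 ab] g0 fg.
pose D : set R := [set` `[- b, b]]; pose P : set R := [set` `[- a, a]].
have mD : measurable D by exact: measurable_itv.
have mP : measurable P by exact: measurable_itv.
have PD : P `<=` D.
  move=> u; rewrite /P /D/= !in_itv/= => /andP[u1 u2].
  by rewrite (le_trans _ u1) ?lerN2// (le_trans u2).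
have DE : D = P `|` (D `\` P) by rewrite setDUK.
have mDP : measurable (D `\` P) by exact: measurableD.
have dPD : [disjoint P & D `\` P].
  by rewrite disj_set2E; apply/eqP; rewrite -subset0 => u [Pu []].
have icont (h : R -> R) : continuous h -> mu.-integrable D (EFin \o h).
  move=> ch; apply: continuous_compact_integrable; first exact: segment_compact.
  exact: continuous_subspaceT.
have ifD := icont _ cf; have igD := icont _ cg.
have split (h : R -> R) : mu.-integrable D (EFin \o h) ->
    \int[mu]_(u in D) h u = \int[mu]_(u in P) h u + \int[mu]_(u in D `\` P) h u.
  by move=> ih; rewrite [in LHS]DE Rintegral_setU// -DE.
rewrite (split f)// (split g)// [X in `|X|]addrC addKr.
have ifDP : mu.-integrable (D `\` P) (EFin \o f) by apply: integrableS ifD => //; exact: subDsetl.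
have igDP : mu.-integrable (D `\` P) (EFin \o g) by apply: integrableS igD => //; exact: subDsetl.
apply: le_trans (le_normr_Rintegral _ ifDP) _ => //.
apply: (@le_trans _ _ (\int[mu]_(u in D `\` P) g u)).
  apply: le_Rintegral => //; first exact: integrable_abse ifDP.
  move=> u [Du Pu]; apply: fg.
    rewrite leNgt; apply/negP => /ltW; rewrite ler_norml => ua; apply: Pu.
    by rewrite /P/= in_itv.
  by move: Du; rewrite /D/= in_itv/= -ler_norml.
by rewrite lerDr; apply: Rintegral_ge0.
Qed.

(** C bounds both the third moment in units of s and the collision probability in units of 1/s; s
    itself may tend to infinity at any rate. The condition [rho <= pi * s0] places the central
    window |u| <= rho sqrt k inside the range |u| <= pi s sqrt k of inversion. *)
Theorem cvg_local_limit (p : nat -> {poly R}) (k n : nat -> nat) (m s : nat -> R)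
    (C s0 rho q : R) :
  0 < rho -> rho <= 1 -> 8 * C * rho <= 1 -> rho <= pi * s0 -> 0 <= q < 1 ->
  k i @[i --> \oo] --> \oo ->
  (forall i, (2 <= k i)%N) ->
  (forall i, (k i)%:R * m i = (n i)%:R) ->
  0 < s0 -> (forall i, s0 <= s i) -> 0 <= C ->
  (forall i j, 0 <= (p i)`_j) ->
  (forall i, \sum_(j < size (p i)) (p i)`_j <= 1) ->
  (forall i, `|\sum_(j < size (p i)) (p i)`_j - 1| <= ((k i)%:R ^+ 2)^-1) ->
  (forall i, `|\sum_(j < size (p i)) (p i)`_j * (j%:R - m i)| <= s i * ((k i)%:R ^+ 2)^-1) ->
  (forall i, `|\sum_(j < size (p i)) (p i)`_j * (j%:R - m i) ^+ 2 - s i ^+ 2| <=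
     s i ^+ 2 * ((k i)%:R ^+ 2)^-1) ->
  (forall i, \sum_(j < size (p i)) (p i)`_j * `|j%:R - m i| ^+ 3 <= C * s i ^+ 3) ->
  (forall i, s i * \sum_(j < size (p i)) (p i)`_j ^+ 2 <= C) ->
  (forall i t, rho <= s i * `|t| -> `|t| <= pi -> normc (charf (p i) (m i) t) <= q) ->
  Num.sqrt (2 * pi) * (s i * Num.sqrt (k i)%:R) * (p i ^+ k i)`_(n i) @[i --> \oo] --> (1 : R).
Proof.
move=> rho0 rho1 rhoC rhos q01 koo k2 km s00 ss C0 p0 p1 h0 h1 h2 h3 h4 qP.
have /andP[q0 q1] := q01.
have k0 i : (0 < k i)%N by rewrite (leq_trans _ (k2 i)).
have k0' i : 0 < (k i)%:R :> R by rewrite ltr0n.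
have si0 i : 0 < s i by rewrite (lt_le_trans s00).
have r0 i : 0 < Num.sqrt (k i)%:R :> R by rewrite sqrtr_gt0.
pose sigma i := s i * Num.sqrt (k i)%:R.
have sigma0 i : 0 < sigma i by rewrite mulr_gt0.
have roo : Num.sqrt (k i)%:R @[i --> \oo] --> (+oo : set_system R).
  apply/cvgryPge => A; near=> i.
  have [A0|A0] := leP A 0; first by rewrite (le_trans A0)// sqrtr_ge0.
  rewrite -[A]ger0_norm ?(ltW A0)// -sqrtr_sqr ler_sqrt//.
  by near: i; move: koo => /(@cvgrnyP R)/cvgryPge; apply.
pose f i (u : R) := complex.Re (charf (p i) (m i) (u / sigma i) ^+ k i).
have fE i : f i = fun u => complex.Re (charf (p i ^+ k i) (n i)%:R (u / sigma i)).
  by apply/funext => u; rewrite /f (charfX _ _ (km i)).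
have cf i : continuous (f i) by rewrite fE; exact: continuous_Re_charf.
pose a i := rho * Num.sqrt (k i)%:R : R.
have a0 i : 0 <= a i by rewrite mulr_ge0 ?(ltW rho0) ?(ltW (r0 i)).
have aoo : a i @[i --> \oo] --> +oo.
  apply/cvgryPge => A; near=> i; rewrite /a -ler_pdivrMl//.
  by near: i; move/cvgryPge: roo; apply.
have aD i : 0 <= a i <= pi * sigma i.
  rewrite a0/= /a /sigma mulrA ler_wpM2r ?(ltW (r0 i))// (le_trans rhos)//.
  by rewrite ler_wpM2l// pi_ge0.
have Jlim : \int[mu]_(u in `[- a i, a i]) f i u @[i --> \oo] --> Num.sqrt (2 * pi).
  apply: (@cvg_gauss_integral f a (expR 3)) => //.
  - move=> u.
    have rV : (Num.sqrt (k i)%:R)^-1 @[i --> \oo] --> (0 : R).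
      by apply/gtr0_cvgV0 => //; exact: nearW.
    pose E : R := 1 + `|u| + u ^+ 2 + 2 * C * `|u| ^+ 3 + u ^+ 4.
    apply: (@cvg_of_dist_le _ (fun i => E / Num.sqrt (k i)%:R)).
      move=> i; have := charf_pointwise u (k0 i) (si0 i) C0 (p0 i) (p1 i)
        (h0 i) (h1 i) (h2 i) (h3 i).
      apply: le_trans; apply: le_trans (Re_le_normc _).
      by rewrite raddfB.
    by rewrite -[X in _ --> X](mulr0 E); apply: cvgM => //; exact: cvg_cst.
  - move=> i u ua; rewrite (le_trans (Re_le_normc _))// normcX.
    exact: (charf_central (k0 i) (si0 i) C0 (p0 i) (h0 i) (h1 i) (h2 i) (h3 i) rho1 rhoC ua).
have IE i : \int[mu]_(u in `[- (pi * sigma i), pi * sigma i]) f i u =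
    2 * pi * sigma i * (p i ^+ k i)`_(n i).
  by rewrite fE Rintegral_charf.
have qs : q ^+ (k i - 2) * Num.sqrt (k i)%:R * (2 * pi * C) @[i --> \oo] --> (0 : R).
  rewrite -[X in _ --> X](mul0r (2 * pi * C)); apply: cvgM; last exact: cvg_cst.
  exact: cvg_geometric_sqrt.
have IJ i : `|\int[mu]_(u in `[- (pi * sigma i), pi * sigma i]) f i u -
    \int[mu]_(u in `[- a i, a i]) f i u| <=
    q ^+ (k i - 2) * Num.sqrt (k i)%:R * (2 * pi * C).
  pose g (u : R) := q ^+ (k i - 2) * normc (charf (p i) (m i) (u / sigma i)) ^+ 2.
  have cg : continuous g.
    by move=> u; apply: cvgM; [exact: cvg_cst|exact: continuous_normc_charf_sqr].
  have g0 u : 0 <= g u by rewrite mulr_ge0// exprn_ge0// normc_ge0.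
  have fg u : a i <= `|u| -> `|u| <= pi * sigma i -> `|f i u| <= g u.
    move=> au uD; rewrite (le_trans (Re_le_normc _))// normcX.
    rewrite -[in leLHS](subnK (k2 i)) exprD /g; apply: ler_wpM2r.
      by rewrite exprn_ge0// normc_ge0.
    rewrite lerXn2r ?nnegrE ?normc_ge0//; apply: qP.
      rewrite normrM normfV (gtr0_norm (sigma0 i)) mulrA ler_pdivlMr// /sigma.
      by rewrite mulrCA ler_pM2l.
    by rewrite normrM normfV (gtr0_norm (sigma0 i)) ler_pdivrMr.
  apply: (le_trans (Rintegral_restrict_le (cf i) cg (aD i) g0 fg)).
  rewrite RintegralZl//=; last first.
    apply: continuous_compact_integrable; first exact: segment_compact.
    by apply: continuous_subspaceT; exact: continuous_normc_charf_sqr.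
  rewrite Rintegral_normc_charf_sqr// -[leRHS]mulrA; apply: ler_wpM2l; first exact: exprn_ge0.
  (* The length of the range brings a factor s sqrt k. The collision bound absorbs s, and the
     geometric factor then has only sqrt k to beat. *)
  have -> : 2 * pi * sigma i * (\sum_(j < size (p i)) (p i)`_j ^+ 2) =
      Num.sqrt (k i)%:R * (2 * pi * (s i * \sum_(j < size (p i)) (p i)`_j ^+ 2)).
    by rewrite /sigma; ring.
  apply: ler_wpM2l; first exact: sqrtr_ge0.
  by apply: ler_wpM2l => //; rewrite mulr_ge0// pi_ge0.
have Ilim : 2 * pi * sigma i * (p i ^+ k i)`_(n i) @[i --> \oo] --> Num.sqrt (2 * pi).
  have dlim : \int[mu]_(u in `[- (pi * sigma i), pi * sigma i]) f i u -
      \int[mu]_(u in `[- a i, a i]) f i u @[i --> \oo] --> (0 : R).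
    by apply: (@cvg_of_dist_le _ _ 0 _ qs) => i; rewrite subr0; exact: IJ.
  rewrite (_ : (fun i => _) = (fun i =>
      (\int[mu]_(u in `[- (pi * sigma i), pi * sigma i]) f i u -
       \int[mu]_(u in `[- a i, a i]) f i u) + \int[mu]_(u in `[- a i, a i]) f i u)).
    by rewrite -[X in _ --> X]add0r; exact: cvgD dlim Jlim.
  by apply/funext => i; rewrite subrK IE.
have sq0 : 0 < Num.sqrt (2 * pi) :> R by rewrite sqrtr_gt0 mulr_gt0// pi_gt0.
have -> : (fun i => Num.sqrt (2 * pi) * (s i * Num.sqrt (k i)%:R) * (p i ^+ k i)`_(n i)) =
    (fun i => 2 * pi * sigma i * (p i ^+ k i)`_(n i) / Num.sqrt (2 * pi)).
  apply/funext => i; apply: (mulIf (lt0r_neq0 sq0)); rewrite divfK ?lt0r_neq0//.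
  rewrite -[in RHS](sqr_sqrtr (a := 2 * pi)); last by rewrite mulr_ge0// pi_ge0.
  by rewrite /sigma; ring.
rewrite -[X in _ --> X](divff (lt0r_neq0 sq0)); apply: cvgM => //; exact: cvg_cst.
Unshelve. all: by end_near. Qed.

End local_limit.

(** * The series of sigma(m)/m *)

Section divisor_sums.
Variable R : realType.
Implicit Types (h g : nat -> R) (r q : R).

Definition divsum h (m : nat) : R := \sum_(1 <= d < m.+1 | (d %| m)%N) h d.

Lemma sum_multiples (d N : nat) g : (0 < d)%N ->
  \sum_(1 <= m < N.+1 | (d %| m)%N) g m = \sum_(1 <= l < (N %/ d).+1) g (d * l)%N.
Proof.
move=> d0; elim: N => [|N IHN]; first by rewrite div0n !big_geq.
rewrite big_mkcond big_nat_recr//= -big_mkcond IHN divnS//.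
case: ifP => [dN|_]; last by rewrite addr0 add0n.
rewrite add1n [RHS]big_nat_recr//=; congr (_ + g _).
have -> : (N %/ d).+1 = (N.+1 %/ d)%N by rewrite divnS// dN.
by rewrite mulnC divnK.
Qed.

Lemma sum_divsum h g (N : nat) :
  \sum_(1 <= m < N.+1) divsum h m * g m =
  \sum_(1 <= d < N.+1) h d * \sum_(1 <= l < (N %/ d).+1) g (d * l)%N.
Proof.
transitivity (\sum_(1 <= m < N.+1) \sum_(1 <= d < N.+1)
    if (d %| m)%N then h d * g m else 0).
  apply: eq_big_nat => m /andP[m1 mN]; rewrite /divsum mulr_suml.
  have tail : \sum_(m.+1 <= d < N.+1) (if (d %| m)%N then h d * g m else 0) = 0.
    rewrite big_nat big1// => d /andP[md _]; case: ifP => // dm.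
    by move: (dvdn_leq m1 dm); rewrite leqNgt md.
  by rewrite [RHS](big_cat_nat (n := m.+1))//= tail addr0 big_mkcond.
rewrite exchange_big_nat/=; apply: eq_big_nat => d /andP[d1 _].
by rewrite -sum_multiples// mulr_sumr -big_mkcond.
Qed.

Lemma divsum_ge0 h m : (forall d, 0 <= h d) -> 0 <= divsum h m.
Proof. by move=> h0; exact: sumr_ge0. Qed.

Lemma geometric_partial_le q (K : nat) : 0 <= q < 1 ->
  \sum_(1 <= l < K) q ^+ l <= q / (1 - q).
Proof.
move=> /andP[q0 q1]; have q1' : 0 < 1 - q by rewrite subr_gt0.
suff H : \sum_(1 <= l < K) q ^+ l <= (q - q ^+ K.-1.+1) / (1 - q).
  rewrite (le_trans H)// ler_wpM2r ?invr_ge0 ?(ltW q1')//.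
  by rewrite lerBlDr lerDl exprn_ge0.
rewrite ler_pdivlMr//; elim: K => [|[|K] IHK].
- by rewrite big_geq// mul0r expr1 subrr.
- by rewrite big_geq// mul0r expr1 subrr.
- rewrite big_nat_recr//= mulrDl.
  have -> : q - q ^+ K.+2 = (q - q ^+ K.+1) + q ^+ K.+1 * (1 - q).
    by rewrite [q ^+ K.+2]exprS; ring.
  by rewrite lerD2r.
Qed.

(** Write 1 - r^d = (1 - r) (1 + ... + r^(d-1)); each of the d terms, times r, is at least r^d. *)
Lemma geometric_pow_le r (d : nat) : (0 < d)%N -> 0 < r < 1 ->
  r ^+ d / (1 - r ^+ d) <= d%:R^-1 * (r / (1 - r)).
Proof.
move=> d0 /andP[r0 r1]; have d0' : 0 < d%:R :> R by rewrite ltr0n.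
have r1' : 0 < 1 - r by rewrite subr_gt0.
have rd : 0 < 1 - r ^+ d by rewrite subr_gt0 exprn_ilt1// ?(ltW r0)// -lt0n.
rewrite ler_pdivrMr// mulrAC [leRHS]mulrC mulrA -mulrA [leRHS]mulrAC.
rewrite mulrA ler_pdivlMr// mulrAC ler_pdivlMr//.
have -> : 1 - r ^+ d = (1 - r) * \sum_(i < d) r ^+ i.
  have := subrX1 r d => H; rewrite -[LHS]opprB H -[in RHS]opprB mulNr; ring.
have H : d%:R * r ^+ d <= r * \sum_(i < d) r ^+ i.
  rewrite mulr_natl -[X in _ *+ X]card_ord -sumr_const mulr_sumr.
  apply: ler_sum => i _; rewrite -exprS ler_wiXn2l// ?(ltW r0)// ?(ltW r1)//.
have := ler_wpM2l (ltW r1') H; lra.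
Qed.

(** The mean value of [divsum h] is the sum of h(d)/d. In the rearranged sum the multiples of d form
    a geometric series of ratio r^d, which has at most 1/d of the mass of the full one. *)
Lemma sum_divsum_le h r (N : nat) (c : R) : (forall d, 0 <= h d) -> 0 < r < 1 ->
  \sum_(1 <= d < N.+1) h d / d%:R <= c ->
  \sum_(1 <= m < N.+1) divsum h m * r ^+ m <= c * (r / (1 - r)).
Proof.
move=> h0 r01 hc; have /andP[r0 r1] := r01; rewrite sum_divsum.
have rr : 0 <= r / (1 - r) by rewrite divr_ge0 ?(ltW r0)// subr_ge0 ltW.
apply: le_trans (ler_wpM2r rr hc); rewrite mulr_suml.
apply: ler_sum_nat => d /andP[d1 _]; rewrite -mulrA; apply: ler_wpM2l => //.
apply: le_trans (geometric_pow_le d1 r01).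
under eq_bigr do rewrite exprM.
by apply: geometric_partial_le; rewrite exprn_ge0 ?(ltW r0)//= exprn_ilt1// ?(ltW r0)// -lt0n.
Qed.

Lemma sum_inv_sqr_le (N : nat) : \sum_(1 <= d < N.+1) (d%:R^-1 / d%:R) <= 2 :> R.
Proof.
case: N => [|N]; first by rewrite big_geq.
(* The bound is strengthened by a telescoping term to make the induction go through. *)
suff H : \sum_(1 <= d < N.+2) (d%:R^-1 / d%:R) <= 2 - N.+1%:R^-1 :> R.
  by rewrite (le_trans H)// lerBlDr lerDl invr_ge0.
elim: N => [|N IHN]; first by rewrite big_nat1 invr1; lra.
rewrite big_nat_recr//=; apply: le_trans (lerD IHN (lexx _)) _.
have n0 : 0 < N.+1%:R :> R by rewrite ltr0n.
have E : N.+2%:R = N.+1%:R + 1 :> R by rewrite natr1.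
rewrite E; set x : R := N.+1%:R in n0 *.
rewrite -subr_ge0; have -> : 2 - (x + 1)^-1 - (2 - x^-1 + (x + 1)^-1 / (x + 1)) =
  (x * (x + 1) ^+ 2)^-1.
  by field; rewrite !gt_eqF// addr_gt0.
by rewrite invr_ge0 mulr_ge0 ?sqr_ge0// ltW.
Qed.

Lemma sum_inv_sqrt_le (N : nat) :
  \sum_(1 <= d < N.+1) ((Num.sqrt d%:R)^-1 / d%:R) <= 3 :> R.
Proof.
case: N => [|N]; first by rewrite big_geq.
suff H : \sum_(1 <= d < N.+2) ((Num.sqrt d%:R)^-1 / d%:R) <= 3 - 2 / Num.sqrt N.+1%:R :> R.
  by rewrite (le_trans H)// lerBlDr lerDl divr_ge0// sqrtr_ge0.
elim: N => [|N IHN]; first by rewrite big_nat1 sqrtr1 invr1; lra.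
rewrite big_nat_recr//=; apply: le_trans (lerD IHN (lexx _)) _.
have t0 : 0 < Num.sqrt N.+1%:R :> R by rewrite sqrtr_gt0.
have s0 : 0 < Num.sqrt N.+2%:R :> R by rewrite sqrtr_gt0.
have sE : (Num.sqrt N.+2%:R)^-1 / N.+2%:R =
    (Num.sqrt N.+2%:R)^-1 / Num.sqrt N.+2%:R ^+ 2 :> R by rewrite sqr_sqrtr.
have stE : Num.sqrt N.+2%:R ^+ 2 = Num.sqrt N.+1%:R ^+ 2 + 1 :> R.
  by rewrite !sqr_sqrtr// natr1.
have st : Num.sqrt N.+1%:R <= Num.sqrt N.+2%:R :> R by rewrite ler_sqrt// ler_nat.
rewrite sE; move: t0 s0 stE st.
set s := Num.sqrt N.+2%:R; set t := Num.sqrt N.+1%:R => t0 s0 stE st.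
rewrite -subr_ge0.
have -> : 3 - 2 / s - (3 - 2 / t + s^-1 / s ^+ 2) =
   (2 * s ^+ 2 * (s - t) - t) / (t * s ^+ 3).
  by field; rewrite !gt_eqF.
rewrite divr_ge0 ?mulr_ge0 ?exprn_ge0 ?(ltW t0) ?(ltW s0)// subr_ge0.
rewrite -(@ler_pM2r _ (s + t)) ?addr_gt0//.
have -> : 2 * s ^+ 2 * (s - t) * (s + t) = 2 * s ^+ 2 * (s ^+ 2 - t ^+ 2) by ring.
rewrite [in s ^+ 2 - _]stE [t ^+ 2 + 1]addrC addrK mulr1.
have := ler_wpM2r (ltW s0) st; have := ler_pM (ltW t0) (ltW t0) st st.
by rewrite [s ^+ 2]expr2; lra.
Qed.

Lemma divsum_inv_ge1 m : (0 < m)%N -> 1 <= divsum (fun d => d%:R^-1) m.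
Proof.
move=> m0; rewrite /divsum big_mkcond big_ltn//= dvd1n invr1 lerDl.
by apply: sumr_ge0 => d _; case: ifP => // _; rewrite invr_ge0.
Qed.

(* Cauchy-Schwarz with weights [d^(-3/2)] and [d^(-1/2)] in a form that only needs AM-GM. *)
Lemma divsum_inv_sqr_le m : divsum (fun d => d%:R^-1) m ^+ 2 <=
  3 * divsum (fun d => (Num.sqrt d%:R)^-1) m.
Proof.
pose w (d : nat) : R := (Num.sqrt d%:R)^-1.
have w0 d : 0 <= w d by rewrite invr_ge0 sqrtr_ge0.
have wE d : d%:R^-1 = w d ^+ 2 by rewrite exprVn sqr_sqrtr.
have w3 : \sum_(1 <= d < m.+1 | (d %| m)%N) w d ^+ 3 <= 3.
  apply: le_trans (sum_inv_sqrt_le m); rewrite big_mkcond.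
  apply: ler_sum => d _; case: ifP => _; last by rewrite mulr_ge0 ?invr_ge0.
  by rewrite wE exprS.
rewrite /divsum.
apply: le_trans (ler_wpM2r (sumr_ge0 _ (fun d _ => w0 d)) w3).
have E : (\sum_(1 <= d < m.+1 | (d %| m)%N) (d%:R^-1 : R)) ^+ 2 =
  \sum_(1 <= d < m.+1 | (d %| m)%N) \sum_(1 <= e < m.+1 | (e %| m)%N) w d ^+ 2 * w e ^+ 2.
  rewrite expr2 mulr_suml; apply: eq_bigr => d _; rewrite mulr_sumr.
  by apply: eq_bigr => e _; rewrite !wE.
have S : \sum_(1 <= d < m.+1 | (d %| m)%N) \sum_(1 <= e < m.+1 | (e %| m)%N) w d ^+ 3 * w e
   = (\sum_(1 <= d < m.+1 | (d %| m)%N) w d ^+ 3) * \sum_(1 <= d < m.+1 | (d %| m)%N) w d.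
  by rewrite mulr_suml; apply: eq_bigr => d _; rewrite mulr_sumr.
have S' : \sum_(1 <= d < m.+1 | (d %| m)%N) \sum_(1 <= e < m.+1 | (e %| m)%N) w e ^+ 3 * w d
   = (\sum_(1 <= d < m.+1 | (d %| m)%N) w d ^+ 3) * \sum_(1 <= d < m.+1 | (d %| m)%N) w d.
  by rewrite exchange_big/=.
suff : 2 * (\sum_(1 <= d < m.+1 | (d %| m)%N) (d%:R^-1 : R)) ^+ 2 <=
    (\sum_(1 <= d < m.+1 | (d %| m)%N) w d ^+ 3) * (\sum_(1 <= d < m.+1 | (d %| m)%N) w d) +
    (\sum_(1 <= d < m.+1 | (d %| m)%N) w d ^+ 3) * (\sum_(1 <= d < m.+1 | (d %| m)%N) w d).
  by lra.
rewrite -{1}S -S' E -big_split/= mulr_sumr; apply: ler_sum => d _.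
rewrite -big_split/= mulr_sumr; apply: ler_sum => e _.
rewrite -subr_ge0; have -> : w d ^+ 3 * w e + w e ^+ 3 * w d - 2 * (w d ^+ 2 * w e ^+ 2) =
  w d * w e * (w d - w e) ^+ 2 by ring.
by rewrite mulr_ge0 ?sqr_ge0// mulr_ge0.
Qed.

(** The squares of sigma(m)/m are bounded on average: Cauchy-Schwarz dominates them by three times a
    divisor sum whose mean value is at most 3. This is the arithmetic input of the collision
    bound. *)
Lemma sum_divsum_sqr_le (N : nat) (r : R) : 0 < r < 1 ->
  \sum_(1 <= m < N.+1) divsum (fun d => d%:R^-1) m ^+ 2 * r ^+ m <= 9 * (r / (1 - r)).
Proof.
move=> r01; have /andP[r0 r1] := r01.
apply: (@le_trans _ _ (3 * \sum_(1 <= m < N.+1) divsum (fun d => (Num.sqrt d%:R)^-1) m * r ^+ m)).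
  rewrite mulr_sumr; apply: ler_sum => m _; rewrite mulrA.
  by apply: ler_wpM2r; [exact/exprn_ge0/ltW|exact: divsum_inv_sqr_le].
suff : \sum_(1 <= m < N.+1) divsum (fun d => (Num.sqrt d%:R)^-1) m * r ^+ m <=
    3 * (r / (1 - r)) by lra.
by apply: sum_divsum_le => //; exact: sum_inv_sqrt_le.
Qed.

Lemma sum_divsum_inv_le (N : nat) (r : R) : 0 < r < 1 ->
  \sum_(1 <= m < N.+1) divsum (fun d => d%:R^-1) m * r ^+ m <= 2 * (r / (1 - r)).
Proof.
move=> r01; apply: sum_divsum_le => //.
exact: sum_inv_sqr_le.
Qed.

End divisor_sums.

(** * The logarithm of (q;q)_oo as a power series *)

Section partition_series.
Variable R : realType.
Implicit Types (r q y : R).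

(** This is sigma(m)/m, since d -> m/d permutes the divisors of m; the value at 0 is an empty
    sum. *)
Definition abundancy : nat -> R := divsum (fun d => d%:R^-1).

Lemma abundancy0 : abundancy 0 = 0.
Proof. by rewrite /abundancy /divsum big_geq. Qed.

Lemma abundancy_ge0 m : 0 <= abundancy m.
Proof. by apply: divsum_ge0 => d; rewrite invr_ge0. Qed.

Lemma pseries_abundancyE r (N : nat) :
  pseries abundancy r N.+1 = \sum_(1 <= m < N.+1) abundancy m * r ^+ m.
Proof. by rewrite /pseries /series/= big_ltn// abundancy0 mul0r add0r. Qed.

Lemma pseries_abundancy_nondecreasing r : 0 <= r -> nondecreasing_seq (pseries abundancy r).
Proof.
move=> r0; apply: nondecreasing_series => n _ _.
by rewrite mulr_ge0 ?abundancy_ge0 ?exprn_ge0.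
Qed.

Lemma pseries_abundancy_le r (N : nat) : 0 < r < 1 -> pseries abundancy r N <= 2 * (r / (1 - r)).
Proof.
move=> r01; have /andP[r0 r1] := r01.
case: N => [|N]; last by rewrite pseries_abundancyE; exact: sum_divsum_inv_le.
by rewrite /pseries /series/= big_geq// mulr_ge0// divr_ge0 ?(ltW r0)// subr_ge0 ltW.
Qed.

Lemma is_cvg_pseries_abundancy r : 0 < r < 1 -> cvgn (pseries abundancy r).
Proof.
move=> r01; have /andP[r0 r1] := r01.
apply: nondecreasing_is_cvgn; first exact/pseries_abundancy_nondecreasing/ltW.
by exists (2 * (r / (1 - r))) => _ [N _ <-]; exact: pseries_abundancy_le.
Qed.

Definition Lser r : R := limn (pseries abundancy r).

Lemma pseries_abundancy_le_Lser r (N : nat) : 0 < r < 1 -> pseries abundancy r N <= Lser r.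
Proof.
move=> r01; apply: nondecreasing_cvgn_le; last exact: is_cvg_pseries_abundancy.
by apply: pseries_abundancy_nondecreasing; case/andP: r01 => /ltW.
Qed.

Lemma Lser_le r : 0 < r < 1 -> Lser r <= 2 * (r / (1 - r)).
Proof.
move=> r01; apply: limr_le; first exact: is_cvg_pseries_abundancy.
by apply: nearW => N; exact: pseries_abundancy_le.
Qed.

Lemma is_derive_expn (n : nat) (x : R) :
  is_derive x 1 (fun x : R => x ^+ n.+1) (n.+1%:R * x ^+ n).
Proof.
elim: n => [|n IHn]; first by rewrite mul1r expr0; exact: is_derive_id.
under eq_fun do rewrite exprS.
apply: is_derive_eq (is_deriveM (is_derive_id x 1) IHn) _.
by rewrite /GRing.scale/= -[n.+2%:R]nat1r !exprS; ring.
Qed.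

(** The derivative of the remainder is x^N/(1 - x), a geometric tail; the mean value theorem on
    [0, q] then gives both the sign and the bound. *)
Lemma ln1B_series q (N : nat) : 0 <= q < 1 ->
  0 <= - ln (1 - q) - \sum_(1 <= j < N.+1) j%:R^-1 * q ^+ j <= q ^+ N / (1 - q).
Proof.
move=> /andP[q0 q1].
pose f (x : R) := - ln (1 - x) - \sum_(1 <= j < N.+1) j%:R^-1 * x ^+ j.
pose f' (x : R) := (1 - x)^-1 - \sum_(1 <= j < N.+1) x ^+ j.-1.
have df (x : R) : x < 1 -> is_derive x 1 f (f' x).
  move=> x1; apply: is_deriveB.
    have x1' : 0 < 1 - x by rewrite subr_gt0.
    have d1 : is_derive x 1 (fun x : R => 1 - x) (-1).
      by apply: is_derive_eq; rewrite /GRing.scale/=; ring.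
    have d2 := is_deriveN (@is_derive1_comp _ (@ln R) (fun x => 1 - x) x _ _ (is_derive1_ln x1') d1).
    by apply: is_derive_eq; rewrite mulrN1 opprK.
  elim: N {f f'} => [|N IHN].
    by under eq_fun do rewrite big_geq//; rewrite big_geq//; exact: is_derive_cst.
  under eq_fun do rewrite big_nat_recr//=; rewrite big_nat_recr//=.
  apply: is_deriveD.
  apply: is_derive_eq (is_deriveZ (N.+1%:R^-1) (is_derive_expn N x)) _.
  by rewrite /GRing.scale/= mulKf// pnatr_eq0.
have f'E (x : R) : x < 1 -> f' x = x ^+ N / (1 - x).
  move=> x1; have x1' : 1 - x != 0 by rewrite gt_eqF// subr_gt0.
  apply: (mulIf x1'); rewrite /f' mulrBl mulVf// divfK// big_add1/=.
  have := subrX1 x N; rewrite big_mkord => H; rewrite mulrC.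
  have -> : (1 - x) * \sum_(i < N) x ^+ i = - (x ^+ N - 1) by rewrite H; ring.
  by ring.
have dI x : x \in `]0, q[ -> is_derive x 1 f (f' x).
  by rewrite in_itv/= => /andP[_ xq]; apply: df; exact: lt_trans q1.
have cI : {within `[0, q], continuous f}.
  apply: derivable_within_continuous => x; rewrite in_itv/= => /andP[_ xq].
  by have /@ex_derive := df _ (le_lt_trans xq q1).
have [c /itvP cq] := MVT_segment q0 dI cI.
have f0 : f 0 = 0.
  rewrite /f subr0 ln1 oppr0 sub0r big_nat big1 ?oppr0// => j /andP[j1 _].
  by rewrite expr0n gtn_eqF// mulr0.
rewrite f0 !subr0 -/(f q) => ->.
have c1 : c < 1 by apply: le_lt_trans q1; rewrite cq.
have cqN : c ^+ N <= q ^+ N by rewrite lerXn2r ?nnegrE ?cq.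
have c1' : 0 < 1 - c by rewrite subr_gt0.
rewrite f'E// mulr_ge0 ?divr_ge0 ?exprn_ge0 ?cq// ?(ltW c1')//=.
have q1' : 0 < 1 - q by rewrite subr_gt0.
apply: (@le_trans _ _ (q ^+ N / (1 - q) * 1)); last by rewrite mulr1.
apply: ler_pM => //; rewrite ?divr_ge0 ?exprn_ge0 ?cq ?(ltW c1')// ?(ltW q1)//.
apply: ler_pM; rewrite ?exprn_ge0 ?invr_ge0 ?cq ?(ltW c1')//.
by rewrite lef_pV2 ?posrE// lerD2l lerN2 cq.
Qed.

(** The left side sums r^(dl)/d over the pairs with d l <= N, all of which lie in the square d, l <=
    N. Along each l the sum over d is a partial sum of the logarithm. *)
Lemma pseries_abundancy_lnE r (N : nat) : 0 < r < 1 ->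
  pseries abundancy r N.+1 <= \sum_(1 <= l < N.+1) - ln (1 - r ^+ l).
Proof.
move=> /andP[r0 r1]; rewrite pseries_abundancyE sum_divsum.
apply: (@le_trans _ _ (\sum_(1 <= d < N.+1) \sum_(1 <= l < N.+1) d%:R^-1 * r ^+ (d * l))).
  apply: ler_sum_nat => d /andP[d1 _]; rewrite -mulr_sumr; apply: ler_wpM2l => //.
  rewrite [leRHS](big_cat_nat (n := (N %/ d).+1))//= ?ltnS ?leq_div//.
  by rewrite lerDl sumr_ge0// => l _; rewrite exprn_ge0// ltW.
rewrite exchange_big_nat/=; apply: ler_sum_nat => l /andP[l1 _].
have rl : 0 <= r ^+ l < 1 by rewrite exprn_ge0 ?(ltW r0)//= exprn_ilt1// ?(ltW r0)// -lt0n.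
have /andP[+ _] := ln1B_series N rl; rewrite subr_ge0; apply: le_trans.
by apply: ler_sum => d _; rewrite mulnC exprM.
Qed.

(** The converse inclusion: the rectangle d <= J, l <= N lies below the hyperbola d l <= N J. Then J
    -> oo with N fixed. *)
Lemma sum_ln_le_Lser r (N : nat) : 0 < r < 1 ->
  \sum_(1 <= l < N.+1) - ln (1 - r ^+ l) <= Lser r.
Proof.
move=> r01; have /andP[r0 r1] := r01.
have [->|N0] := posnP N.
  rewrite big_geq//; have := pseries_abundancy_le_Lser 0 r01.
  by rewrite /pseries /series/= big_geq.
have rl l : (0 < l)%N -> 0 <= r ^+ l < 1.
  by move=> l1; rewrite exprn_ge0 ?(ltW r0)//= exprn_ilt1// ?(ltW r0)// -lt0n.
have H (J : nat) : \sum_(1 <= l < N.+1) \sum_(1 <= d < J.+1) d%:R^-1 * (r ^+ l) ^+ d <= Lser r.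
  apply: le_trans (pseries_abundancy_le_Lser ((N * J).+1) r01).
  rewrite pseries_abundancyE sum_divsum exchange_big_nat/=.
  have JNJ : (J.+1 <= (N * J).+1)%N by rewrite ltnS leq_pmull.
  rewrite [leRHS](big_cat_nat (n := J.+1))//=.
  apply: ler_wpDr.
    apply: sumr_ge0 => d _; rewrite mulr_ge0// sumr_ge0// => l _.
    by rewrite exprn_ge0// ltW.
  apply: ler_sum_nat => d /andP[d1 dJ]; rewrite mulr_sumr.
  rewrite [leRHS](big_cat_nat (n := N.+1))//=; last first.
    by rewrite ltnS leq_divRL// leq_mul2l -ltnS dJ orbT.
  apply: ler_wpDr.
    by apply: sumr_ge0 => l _; rewrite mulr_ge0// exprn_ge0// ltW.
  by apply: ler_sum => l _; rewrite -exprM mulnC.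
have lim1 q : 0 <= q < 1 ->
    \sum_(1 <= d < J.+1) d%:R^-1 * q ^+ d @[J --> \oo] --> - ln (1 - q).
  move=> q01; have /andP[q0 q1] := q01.
  apply: (@cvg_of_dist_le _ _ (fun J => q ^+ J / (1 - q))).
    move=> J; have /andP[h1 h2] := ln1B_series J q01.
    by rewrite distrC ger0_norm.
  rewrite -[X in _ --> X](mul0r (1 - q)^-1); apply: cvgM; last exact: cvg_cst.
  by apply: cvg_expr; rewrite ger0_norm.
rewrite big_add1/=.
have lim : \sum_(0 <= l < N) \sum_(1 <= d < J.+1) d%:R^-1 * (r ^+ l.+1) ^+ d @[J --> \oo] -->
    \sum_(0 <= l < N) - ln (1 - r ^+ l.+1).
  by apply: cvg_big => [|l _]; [exact: add_continuous|exact/lim1/rl].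
rewrite -(cvg_lim _ lim)//; apply: limr_le; first exact: cvgP lim.
by apply: nearW => J; have := H J; rewrite big_add1.
Qed.

Lemma qpoch_Lser r : 0 < r < 1 -> qpoch r = expR (- Lser r).
Proof.
move=> r01; have /andP[r0 r1] := r01.
have rl l : (0 < l)%N -> 0 < 1 - r ^+ l.
  by move=> l1; rewrite subr_gt0 exprn_ilt1// ?(ltW r0)// -lt0n.
apply/cvg_lim => //.
have PE (N : nat) : \prod_(1 <= p < N.+1) (1 - r ^+ p) =
    expR (- \sum_(1 <= l < N.+1) - ln (1 - r ^+ l)).
  rewrite -sumrN expR_sum; apply: eq_big_nat => p /andP[p1 _].
  by rewrite opprK lnK// posrE rl.
under eq_fun do rewrite PE.
apply: continuous_cvg; first exact: continuous_expR.
apply: cvgN; apply: (@squeeze_cvgr _ _ _ _ (fun N => pseries abundancy r N.+1) (fun=> Lser r)).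
- by apply: nearW => N; rewrite pseries_abundancy_lnE// sum_ln_le_Lser.
- by rewrite cvg_shiftS; exact: is_cvg_pseries_abundancy.
- exact: cvg_cst.
Qed.

Lemma F_Lser y : 0 < y -> F y = Lser (expR (- y)).
Proof.
move=> y0; rewrite /F qpoch_Lser ?expRK ?opprK//.
by rewrite expR_gt0/= -expR0 ltr_expR oppr_lt0.
Qed.

End partition_series.

(** * Identification of the d'Arcais numbers *)

Section power_series.
Variable R : realType.
Implicit Types (f d : nat -> R) (x z : R).

Lemma natrM_expr_le (rho : R) (i : nat) : 0 <= rho < 1 ->
  i.+1%:R * rho ^+ i <= (1 - rho)^-1.
Proof.
move=> /andP[rho0 rho1]; have rho1' : 0 < 1 - rho by rewrite subr_gt0.
apply: (@le_trans _ _ (\sum_(j < i.+1) rho ^+ j)).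
  rewrite mulr_natl -[X in _ *+ X]card_ord -sumr_const.
  by apply: ler_sum => j _; rewrite ler_wiXn2l// ?(ltW rho1)// -ltnS.
rewrite -[leRHS]mul1r ler_pdivlMr// mulrC.
have := subrX1 rho i.+1 => H.
have -> : (1 - rho) * \sum_(j < i.+1) rho ^+ j = 1 - rho ^+ i.+1.
  by rewrite -[RHS]opprB H; ring.
by rewrite lerBlDr lerDl exprn_ge0.
Qed.

(** Comparison at a radius w between |z| and |x|: the factor (i+1) (|z|/w)^i produced by
    differentiation is bounded. *)
Lemma is_cvg_pseries_diffs f x z : cvgn (pseries f x) -> `|z| < `|x| ->
  cvgn (pseries (pseries_diffs f) z).
Proof.
move=> fx zx; pose w := (`|z| + `|x|) / 2.
have z0 := normr_ge0 z.
have zw : `|z| < w by rewrite /w; lra.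
have wx : w < `|x| by rewrite /w; lra.
have w0 : 0 < w by rewrite (le_lt_trans z0).
pose rho := `|z| / w.
have rho01 : 0 <= rho < 1 by rewrite divr_ge0 ?(ltW w0)//= ltr_pdivrMr ?mul1r.
have wx' : `|w| < `|x| by rewrite (gtr0_norm w0).
have fw := is_cvg_pseries_inside_norm fx wx'.
have rV : 0 < (1 - rho)^-1 by rewrite invr_gt0 subr_gt0; case/andP: rho01.
apply: normed_cvg.
pose g i := (w^-1 * (1 - rho)^-1) * (`|f i.+1| * w ^+ i.+1).
have g0 i : 0 <= g i.
  by rewrite !mulr_ge0 ?exprn_ge0 ?invr_ge0 ?(ltW w0) ?(ltW rV)// -invr_ge0 ltW.
apply: (@series_le_cvg _ _ g) => //.
- by move=> i; exact: normr_ge0.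
- move=> i /=; rewrite /pseries_diffs !normrM normrX normr_nat.
  have -> : i.+1%:R * `|f i.+1| * `|z| ^+ i =
      w^-1 * (i.+1%:R * rho ^+ i) * (`|f i.+1| * w ^+ i.+1).
    by rewrite /rho exprMn exprVn exprS; field; rewrite expf_neq0// lt0r_neq0.
  rewrite /g; apply: ler_wpM2r; first by rewrite mulr_ge0// exprn_ge0// ltW.
  by apply: ler_wpM2l; [rewrite invr_ge0 ltW|exact: natrM_expr_le].
- have -> : series g = fun n => (w^-1 * (1 - rho)^-1) *
      (pseries (fun i => `|f i|) w n.+1 - `|f 0%N|).
    apply/funext => n; rewrite /series/= /pseries /series/= big_nat_recl//= expr0 mulr1.
    by rewrite addrAC subrr add0r mulr_sumr.
  apply: is_cvgM; first exact: is_cvg_cst.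
  apply: is_cvgB; last exact: is_cvg_cst.
  by apply/cvg_ex; exists (limn (pseries (fun i => `|f i|) w)); rewrite cvg_shiftS.
Qed.

Lemma pseries_shift d z (n : nat) : pseries d z n.+1 = d 0%N + z * pseries (d \o S) z n.
Proof.
rewrite /pseries /series/= big_nat_recl//= expr0 mulr1; congr (_ + _).
by rewrite mulr_sumr; apply: eq_bigr => i _; rewrite exprS; ring.
Qed.

(** An identity theorem from values on (0, 1) only: the constant term is the limit at 0 from the
    right, by continuity of the sum; dividing by z shifts the coefficients. *)
Lemma pseries_eq0 d : (forall z, 0 < z < 1 -> pseries d z n @[n --> \oo] --> (0 : R)) ->
  forall n, d n = 0.
Proof.
suff H d' : (forall z, 0 < z < 1 -> pseries d' z n @[n --> \oo] --> (0 : R)) -> d' 0%N = 0.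
  move=> + n; elim: n d => [|n IHn] d dz; first exact: H.
  apply: (IHn (d \o S)) => z z01; have /andP[z0 z1] := z01.
  have d0 := H _ dz.
  have -> : pseries (d \o S) z = (fun m => z^-1 * pseries d z m.+1).
    by apply/funext => m; rewrite pseries_shift d0 add0r mulKf// gt_eqF.
  rewrite -[X in _ --> X](mulr0 z^-1); apply: cvgM; first exact: cvg_cst.
  by rewrite cvg_shiftS; exact: dz.
move=> dz.
(* Continuity at 0 comes from termwise differentiation, which asks for convergence of the first two
   derived series; each derivation shrinks the radius, here from 1/2 through 1/3 to 1/4. *)
have c2 : cvgn (pseries d' (2^-1)) by apply/cvg_ex; exists 0; apply: dz; lra.
have lt34 (a b : R) : 0 < a -> a < b -> `|a| < `|b|.
  by move=> a0 ab; rewrite !gtr0_norm// (lt_trans a0).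
have c3 : cvgn (pseries d' (3^-1)) by apply: is_cvg_pseries_inside c2 _; apply: lt34; lra.
have c4 : cvgn (pseries (pseries_diffs d') (3^-1)).
  by apply: is_cvg_pseries_diffs c2 _; apply: lt34; lra.
have c5 : cvgn (pseries (pseries_diffs (pseries_diffs d')) (4^-1)).
  by apply: is_cvg_pseries_diffs c4 _; apply: lt34; lra.
have c4' : cvgn (pseries (pseries_diffs d') (4^-1)).
  by apply: is_cvg_pseries_inside c4 _; apply: lt34; lra.
have c3' : cvgn (pseries d' (4^-1)).
  by apply: is_cvg_pseries_inside c3 _; apply: lt34; lra.
have := @pseries_snd_diffs _ d' (4^-1) 0 c3' c4' c5.
rewrite normr0 normr_gt0 invr_eq0 pnatr_eq0 => /(_ erefl) dd.
have cont : {for 0, continuous (fun x => limn (pseries d' x))}.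
  by apply: differentiable_continuous; apply/derivable1_diffP; exact: (@ex_derive _ _ _ _ _ _ _ dd).
have e0 : limn (pseries d' 0) = d' 0%N.
  apply/cvg_lim => //; rewrite -cvg_shiftS.
  under eq_fun do rewrite pseries_shift mul0r addr0.
  exact: cvg_cst.
have h1 : limn (pseries d' x) @[x --> 0^'+] --> limn (pseries d' 0).
  exact: cvg_at_right_filter cont.
have h2 : limn (pseries d' x) @[x --> 0^'+] --> (0 : R).
  apply: cvg_near_cst; near=> x; apply/cvg_lim => //; apply: dz.
  by apply/andP; split; near: x; [exact: nbhs_right_gt|exact: nbhs_right_lt].
by rewrite -e0 -(cvg_lim _ h1)// (cvg_lim _ h2).
Unshelve. all: by end_near. Qed.

Lemma poly_eq0_nonneg (p : {poly R}) : (forall x, 0 <= x -> p.[x] = 0) -> p = 0.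
Proof.
move=> px; apply: (@roots_geq_poly_eq0 _ _ [seq (i%:R : R) | i <- iota 0 (size p)]).
- by apply/allP => _ /mapP[i _ ->]; apply/rootP/px.
- by rewrite map_inj_uniq ?iota_uniq// => i j /eqP; rewrite eqr_nat => /eqP.
- by rewrite size_map size_iota.
Qed.

End power_series.

Section poly_coefficients.
Variable R : realType.
Implicit Types (p q : {poly R}).

Lemma coef_exp_ge0 p k i : (forall j, 0 <= p`_j) -> 0 <= (p ^+ k)`_i.
Proof.
move=> p0; elim: k i => [|k IHk] i; first by rewrite expr0 coef1 ler0n.
by rewrite exprS coefM sumr_ge0// => j _; rewrite mulr_ge0.
Qed.

Lemma coef_exp_le p q k i : (forall j, 0 <= p`_j <= q`_j) -> (p ^+ k)`_i <= (q ^+ k)`_i.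
Proof.
move=> pq; have p0 j : 0 <= p`_j by case/andP: (pq j).
elim: k i => [|k IHk] i; first by rewrite !expr0.
rewrite !exprS !coefM; apply: ler_sum => j _.
by apply: ler_pM => //; [exact: coef_exp_ge0|case/andP: (pq j)].
Qed.

Lemma coef_exp_eq p q k n i : (forall j, (j <= n)%N -> p`_j = q`_j) -> (i <= n)%N ->
  (p ^+ k)`_i = (q ^+ k)`_i.
Proof.
move=> pq; elim: k i => [|k IHk] i ni; first by rewrite !expr0.
rewrite !exprS !coefM; apply: eq_bigr => j _.
have ji : (j <= i)%N by rewrite -ltnS.
by rewrite pq ?(leq_trans ji)// IHk// (leq_trans (leq_subr _ _)).
Qed.

Lemma coef_exp_small p k i : p`_0 = 0 -> (i < k)%N -> (p ^+ k)`_i = 0.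
Proof.
move=> p0; elim: k i => // k IHk i; rewrite ltnS => ik.
rewrite exprS coefM big1// => j _.
have [->|j0] := posnP j; first by rewrite p0 mul0r.
have ji : (j <= i)%N by rewrite -ltnS.
have ij : (i - j < k)%N by apply: leq_trans ik; rewrite ltn_subrL j0 (leq_trans j0).
by rewrite IHk ?mulr0.
Qed.

Lemma coef_sum_le_horner p (N : nat) (z : R) : (forall j, 0 <= p`_j) -> 0 <= z ->
  \sum_(0 <= n < N) p`_n * z ^+ n <= p.[z].
Proof.
move=> p0 z0; rewrite horner_coef -(big_mkord xpredT (fun i => p`_i * z ^+ i)).
have t0 i : 0 <= p`_i * z ^+ i by rewrite mulr_ge0// exprn_ge0.
have [Np|pN] := leqP N (size p).
  by rewrite [leRHS](big_cat_nat (n := N))//= lerDl sumr_ge0.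
rewrite (big_cat_nat (n := size p))//=; last exact: ltnW.
have tail : \sum_(size p <= i < N) p`_i * z ^+ i = 0.
  by rewrite big_nat big1// => i /andP[pi _]; rewrite nth_default// mul0r.
by rewrite tail addr0.
Qed.

Lemma horner_coef_sum p (N : nat) (z : R) : (size p <= N)%N ->
  p.[z] = \sum_(0 <= n < N) p`_n * z ^+ n.
Proof. by move=> pN; rewrite (horner_coef_wide _ pN) big_mkord. Qed.

End poly_coefficients.

Section dArcais_coefficients.
Variable R : realType.

Definition Lpoly (M : nat) : {poly R} := \poly_(m < M.+1) abundancy R m.

(** The coefficient of z^n in L^k for the full series L: terms of degree above n cannot
    contribute. *)
Definition Lcoef (n k : nat) : R := (Lpoly n ^+ k)`_n.

Lemma coef_Lpoly M i : (Lpoly M)`_i = if (i < M.+1)%N then abundancy R i else 0.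
Proof. by rewrite coef_poly. Qed.

Lemma coef_Lpoly_ge0 M i : 0 <= (Lpoly M)`_i.
Proof. by rewrite coef_Lpoly; case: ifP => // _; exact: abundancy_ge0. Qed.

Lemma Lpoly_exp_stable M n k : (n <= M)%N -> (Lpoly M ^+ k)`_n = Lcoef n k.
Proof.
move=> nM; apply: (@coef_exp_eq _ _ _ _ n) => // j jn.
by rewrite !coef_Lpoly !ltnS jn (leq_trans jn nM).
Qed.

Lemma Lpoly_exp_le M n k : (Lpoly M ^+ k)`_n <= Lcoef n k.
Proof.
have [nM|Mn] := leqP n M; first by rewrite Lpoly_exp_stable.
apply: coef_exp_le => j; rewrite coef_Lpoly_ge0 !coef_Lpoly !ltnS.
case: (leqP j M) => jM; first by rewrite (leq_trans jM (ltnW Mn)) lexx.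
by case: ifP => //= _; exact: abundancy_ge0.
Qed.

Lemma Lcoef_ge0 n k : 0 <= Lcoef n k.
Proof. exact/coef_exp_ge0/coef_Lpoly_ge0. Qed.

Lemma Lcoef_small n k : (n < k)%N -> Lcoef n k = 0.
Proof. by apply: coef_exp_small; rewrite coef_Lpoly abundancy0. Qed.

Lemma horner_Lpoly M z : (Lpoly M).[z] = pseries (abundancy R) z M.+1.
Proof. by rewrite horner_poly /pseries /series/= big_mkord. Qed.

Lemma exp_coeff_partial_le (x : R) (N : nat) : 0 <= x ->
  \sum_(0 <= k < N) x ^+ k / k`!%:R <= expR x.
Proof.
move=> x0; have := @nondecreasing_cvgn_le _ (series (exp_coeff x)).
rewrite /expR; apply; last exact: is_cvg_series_exp_coeff.
by apply: nondecreasing_series => n _ _; exact: exp_coeff_ge0.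
Qed.

(** A double series of nonnegative terms, rearranged by monotonicity; this is why x >= 0. The upper
    bound cuts L at degree N. The lower bound fixes a cutoff K in k and M in degree, then lets M and
    afterwards K tend to infinity. *)
Lemma exp_Lser_series (x z : R) : 0 <= x -> 0 < z < 1 ->
  \sum_(0 <= n < N) (\sum_(0 <= k < n.+1) Lcoef n k / k`!%:R * x ^+ k) * z ^+ n
    @[N --> \oo] --> expR (x * Lser z).
Proof.
move=> x0 z01; have /andP[z0 z1] := z01.
pose b n := \sum_(0 <= k < n.+1) Lcoef n k / k`!%:R * x ^+ k.
pose B (N : nat) := \sum_(0 <= n < N) b n * z ^+ n.
have xk0 k : 0 <= x ^+ k / k`!%:R by rewrite divr_ge0// exprn_ge0.
have t0 n k : 0 <= Lcoef n k / k`!%:R * x ^+ k.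
  by rewrite mulrAC -mulrA mulr_ge0// Lcoef_ge0.
have b0 n : 0 <= b n by apply: sumr_ge0.
have zn0 n : 0 <= z ^+ n by rewrite exprn_ge0// ltW.
have bE n K : (n < K)%N -> b n = \sum_(0 <= k < K) x ^+ k / k`!%:R * Lcoef n k.
  move=> nK; rewrite [RHS](big_cat_nat (n := n.+1))//=.
  have tail : \sum_(n.+1 <= k < K) x ^+ k / k`!%:R * Lcoef n k = 0.
    by rewrite big_nat big1// => k /andP[nk _]; rewrite Lcoef_small ?mulr0.
  by rewrite tail addr0; apply: eq_bigr => k _; rewrite mulrC mulrAC mulrA.
have swap (N K : nat) (c : nat -> nat -> R) :
    \sum_(0 <= n < N) (\sum_(0 <= k < K) x ^+ k / k`!%:R * c n k) * z ^+ n =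
    \sum_(0 <= k < K) x ^+ k / k`!%:R * \sum_(0 <= n < N) c n k * z ^+ n.
  under eq_bigr do rewrite mulr_suml.
  rewrite exchange_big_nat/=; apply: eq_bigr => k _; rewrite mulr_sumr.
  by apply: eq_bigr => n _; rewrite mulrA.
have Bub N : B N <= expR (x * Lser z).
  have L0 : 0 <= Lser z.
    by have := pseries_abundancy_le_Lser 0 z01; rewrite /pseries /series/= big_geq.
  apply: le_trans (exp_coeff_partial_le N (mulr_ge0 x0 L0)).
  rewrite /B (eq_big_nat _ _ (F2 := fun n =>
    (\sum_(0 <= k < N) x ^+ k / k`!%:R * Lcoef n k) * z ^+ n)); last first.
    by move=> n /andP[_ nN]; rewrite (bE n N).
  rewrite swap; apply: ler_sum => k _.
  rewrite exprMn [leRHS]mulrAC; apply: ler_wpM2l => //.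
  apply: (@le_trans _ _ (Lpoly N ^+ k).[z]).
    rewrite (eq_big_nat _ _ (F2 := fun n => (Lpoly N ^+ k)`_n * z ^+ n)); last first.
      by move=> n /andP[_ nN]; rewrite Lpoly_exp_stable// ltnW.
    apply: coef_sum_le_horner; last exact: ltW.
    by move=> j; exact/coef_exp_ge0/coef_Lpoly_ge0.
  rewrite horner_exp lerXn2r ?nnegrE// horner_Lpoly ?pseries_abundancy_le_Lser//.
  by apply: sumr_ge0 => i _; rewrite mulr_ge0// abundancy_ge0.
have Bnd : nondecreasing_seq B.
  by apply: nondecreasing_series => n _ _; rewrite mulr_ge0.
have Bcvg : cvgn B.
  by apply: nondecreasing_is_cvgn => //; exists (expR (x * Lser z)) => _ [N _ <-].
have Blim : limn B = expR (x * Lser z).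
  apply/eqP; rewrite eq_le; apply/andP; split.
    by apply: limr_le => //; exact: nearW.
  have low (K M : nat) : \sum_(0 <= k < K) x ^+ k / k`!%:R * pseries (abundancy R) z M.+1 ^+ k <= limn B.
    (* N exceeds the degrees of all the powers involved, so their values at z are partial sums of
       length N. *)
    pose N := maxn K (\max_(k < K) size (Lpoly M ^+ k)).
    apply: le_trans (nondecreasing_cvgn_le Bnd Bcvg N).
    rewrite -horner_Lpoly.
    rewrite (eq_big_nat _ _ (F2 := fun k => x ^+ k / k`!%:R *
      \sum_(0 <= n < N) (Lpoly M ^+ k)`_n * z ^+ n)); last first.
      move=> k /andP[_ kK]; rewrite -horner_exp (@horner_coef_sum _ _ N)//.
      rewrite leq_max; apply/orP; right.
      exact: (leq_bigmax (F := fun k : 'I_K => size (Lpoly M ^+ k)) (Ordinal kK)).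
    rewrite -swap; apply: ler_sum => n _; apply: ler_wpM2r => //.
    apply: (@le_trans _ _ (\sum_(0 <= k < K) x ^+ k / k`!%:R * Lcoef n k)).
      by apply: ler_sum => k _; apply: ler_wpM2l => //; exact: Lpoly_exp_le.
    rewrite (bE n (maxn K n.+1)) ?leq_maxr//.
    rewrite [leRHS](big_cat_nat (n := K)) ?leq_maxl//= lerDl sumr_ge0// => k _.
    by rewrite mulr_ge0// Lcoef_ge0.
  have low2 (K : nat) : \sum_(0 <= k < K) (x * Lser z) ^+ k / k`!%:R <= limn B.
    have lim : \sum_(0 <= k < K) x ^+ k / k`!%:R * pseries (abundancy R) z M.+1 ^+ k @[M --> \oo] -->
        \sum_(0 <= k < K) x ^+ k / k`!%:R * Lser z ^+ k.
      apply: cvg_big => [|k _]; first exact: add_continuous.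
      apply: cvgM; first exact: cvg_cst.
      have pl : pseries (abundancy R) z M.+1 @[M --> \oo] --> Lser z.
        by rewrite cvg_shiftS; exact: is_cvg_pseries_abundancy.
      exact: (cvg_comp _ _ pl (@exprn_continuous R k (Lser z))).
    under eq_bigr do rewrite exprMn mulrAC.
    rewrite -(cvg_lim _ lim)//; apply: limr_le; first exact: cvgP lim.
    by apply: nearW => M; exact: low.
  rewrite {1}/expR; apply: limr_le; first exact: is_cvg_series_exp_coeff.
  by apply: nearW => K; exact: low2.
by rewrite -Blim.
Qed.

(** Coefficients of z^n are compared first, for each fixed x >= 0; the resulting polynomials in x
    agree on a half-line, hence identically. *)
Lemma dArcais_coef (A : nat -> nat -> R) (n k : nat) : is_dArcais2 A ->
  (0 < n)%N -> (k <= n)%N -> k`!%:R * A n k / n`!%:R = Lcoef n k.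
Proof.
move=> hA n0 kn.
pose u x n := \sum_(0 <= k < n.+1) A n k / n`!%:R * x ^+ k.
pose v x n := \sum_(0 <= k < n.+1) Lcoef n k / k`!%:R * x ^+ k.
have uv x : 0 <= x -> u x n = v x n.
  (* Index 0 is set to 0 by hand: the generating function displays its constant term as 1 and does
     not constrain [A 0 0]. *)
  move=> x0; pose d n := if n is 0%N then 0 else u x n - v x n.
  suff : d n = 0 by rewrite /d; case: n n0 {kn} => // m _ /eqP; rewrite subr_eq0 => /eqP.
  apply: pseries_eq0 => z z01; have /andP[z0 z1] := z01.
  have h1 : 1 + \sum_(1 <= n < N.+1) u x n * z ^+ n @[N --> \oo] --> expR (x * Lser z).
    have := hA x z; rewrite (gtr0_norm z0) => /(_ z1).
    rewrite qpoch_Lser// expRK mulrN mulNr opprK.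
    suff -> : (fun N => 1 + \sum_(1 <= n < N.+1) u x n * z ^+ n) =
      (fun N : nat => 1 + \sum_(1 <= n < N.+1) \sum_(0 <= k < n.+1)
          A n k / n`!%:R * x ^+ k * z ^+ n) by [].
    by apply/funext => N; congr (_ + _); apply: eq_bigr => m _; rewrite mulr_suml.
  have h2 : \sum_(0 <= n < N.+1) v x n * z ^+ n @[N --> \oo] --> expR (x * Lser z).
    by rewrite (cvg_shiftS (fun N => \sum_(0 <= n < N) v x n * z ^+ n)); exact: exp_Lser_series.
  rewrite -[X in _ --> X](subrr (expR (x * Lser z))) -cvg_shiftS.
  suff -> : (fun N => pseries d z N.+1) = (fun N => 1 + \sum_(1 <= n < N.+1) u x n * z ^+ n
     - \sum_(0 <= n < N.+1) v x n * z ^+ n) by exact: cvgB.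
  apply/funext => N; rewrite /pseries /series/= big_ltn// mul0r add0r.
  rewrite [X in _ - X]big_ltn//.
  have -> : v x 0%N * z ^+ 0 = 1.
    by rewrite /v big_nat1 /Lcoef !expr0 fact0 coef1 divr1 !mulr1.
  rewrite opprD addrACA subrr add0r -sumrB; apply: eq_big_nat => m /andP[m1 _].
  by rewrite /d; case: m m1 => // m _; rewrite mulrBl.
pose P : {poly R} := \poly_(k < n.+1) (A n k / n`!%:R - Lcoef n k / k`!%:R).
have P0 : P = 0.
  apply: poly_eq0_nonneg => x x0; rewrite horner_poly.
  under eq_bigr do rewrite mulrBl.
  by rewrite sumrB; have := uv _ x0; rewrite /u /v !big_mkord => ->; rewrite subrr.
have := congr1 (fun p : {poly R} => p`_k) P0.
rewrite coef_poly ltnS kn coef0 => /eqP; rewrite subr_eq0 => /eqP kE.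
by rewrite -mulrA kE mulrCA divff ?mulr1// pnatr_eq0 -lt0n fact_gt0.
Qed.

End dArcais_coefficients.

(** * Moments of the tilted distributions *)

Section moments.
Variable R : realType.
Implicit Types (y : R) (j N : nat).

Definition powa j (i : nat) : R := i%:R ^+ j * abundancy R i.

(** For y > 0, the j-th moment of X before division by F(y), that is (-1)^j times the j-th
    derivative of F. *)
Definition mom j y : R := limn (pseries (powa j) (expR (- y))).

Lemma expRN_itv y : 0 < y -> 0 < expR (- y) < 1.
Proof. by move=> y0; rewrite expR_gt0/= -expR0 ltr_expR oppr_lt0. Qed.

Lemma powa_ge0 j i : 0 <= powa j i.
Proof. by rewrite mulr_ge0 ?exprn_ge0 ?abundancy_ge0. Qed.

Lemma geometric_ratio_le y : 0 < y -> expR (- y) / (1 - expR (- y)) <= y^-1.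
Proof.
move=> y0; have /andP[_ r1] := expRN_itv y0.
rewrite ler_pdivrMr ?subr_gt0// ler_pdivlMl//.
have := expR_ge1Dx y; rewrite expRN => H.
have e0 := expR_gt0 y.
rewrite -(ler_pM2r e0) -mulrA mulVf ?gt_eqF// mulr1 mulrBl mul1r mulVf ?gt_eqF//.
by rewrite lerBrDr addrC.
Qed.

Lemma geometric_ratio_ge (Y y : R) : 0 < y <= Y ->
  expR (- Y) / y <= expR (- y) / (1 - expR (- y)).
Proof.
move=> /andP[y0 yY]; have /andP[_ r1] := expRN_itv y0.
apply: ler_pM; rewrite ?expR_ge0 ?invr_ge0 ?(ltW y0)//; first by rewrite ler_expR lerN2.
rewrite lef_pV2 ?posrE ?subr_gt0//.
by have := expR_ge1Dx (- y); lra.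
Qed.

Lemma exprn_expR_le (j : nat) (x : R) : 0 <= x -> x ^+ j <= j`!%:R * expR x.
Proof.
move=> x0; case: j => [|j].
  by rewrite expr0 fact0 mul1r -expR0 ler_expR.
rewrite mulrC -ler_pdivrMr ?ltr0n ?fact_gt0//.
by apply: le_trans (expR_ge1Dxn j x0); rewrite lerDr.
Qed.

(** Half of the exponent pays for the power: (i y/2)^j <= j! e^(i y/2). *)
Lemma pow_expR_le j (i : nat) y : 0 < y ->
  i%:R ^+ j * expR (- y) ^+ i <= j`!%:R * (2 / y) ^+ j * expR (- (y / 2)) ^+ i.
Proof.
move=> y0; rewrite -!expRM_natl.
have h0 : 0 <= i%:R * (y / 2) by rewrite mulr_ge0// divr_ge0// ltW.
have := exprn_expR_le j h0 => H.
have -> : i%:R ^+ j = (2 / y) ^+ j * (i%:R * (y / 2)) ^+ j.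
  by rewrite -exprMn; congr (_ ^+ j); field; rewrite gt_eqF.
have -> : i%:R * - y = - (i%:R * (y / 2)) + i%:R * - (y / 2) by field.
rewrite expRD mulrA; apply: ler_wpM2r; first exact: expR_ge0.
rewrite expRN ler_pdivrMr ?expR_gt0// [j`!%:R * _]mulrC -mulrA.
by apply: ler_wpM2l => //; rewrite exprn_ge0// divr_ge0// ltW.
Qed.

Lemma pseries_powa_le j y N : 0 < y ->
  pseries (powa j) (expR (- y)) N <= j`!%:R * (2 / y) ^+ j * (4 / y).
Proof.
move=> y0; have y20 : 0 < y / 2 by rewrite divr_gt0.
have c0 : 0 <= j`!%:R * (2 / y) ^+ j by rewrite mulr_ge0// exprn_ge0// divr_ge0// ltW.
apply: (@le_trans _ _ (j`!%:R * (2 / y) ^+ j * pseries (abundancy R) (expR (- (y / 2))) N)).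
  rewrite /pseries /series/= mulr_sumr; apply: ler_sum => i _.
  rewrite /powa mulrAC [leRHS]mulrCA [leRHS]mulrC; apply: ler_wpM2r; first exact: abundancy_ge0.
  exact: pow_expR_le.
apply: ler_wpM2l => //; apply: le_trans (pseries_abundancy_le N (expRN_itv y20)) _.
have := geometric_ratio_le y20; rewrite invfM invrK.
by move=> H; have := ler_wpM2l (ler0n R 2) H; lra.
Qed.

Lemma pseries_powa_nondecreasing j y : nondecreasing_seq (pseries (powa j) (expR (- y))).
Proof.
apply: nondecreasing_series => n _ _.
by rewrite mulr_ge0 ?powa_ge0 ?exprn_ge0 ?expR_ge0.
Qed.

Lemma is_cvg_powa j y : 0 < y -> cvgn (pseries (powa j) (expR (- y))).
Proof.
move=> y0; apply: nondecreasing_is_cvgn; first exact: pseries_powa_nondecreasing.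
by exists (j`!%:R * (2 / y) ^+ j * (4 / y)) => _ [N _ <-]; exact: pseries_powa_le.
Qed.

Lemma mom_le j y : 0 < y -> mom j y <= j`!%:R * (2 / y) ^+ j * (4 / y).
Proof.
move=> y0; apply: limr_le; first exact: is_cvg_powa.
by apply: nearW => N; exact: pseries_powa_le.
Qed.

Lemma pseries_powa_le_mom j y N : 0 < y -> pseries (powa j) (expR (- y)) N <= mom j y.
Proof.
move=> y0; apply: nondecreasing_cvgn_le; [exact: pseries_powa_nondecreasing|exact: is_cvg_powa].
Qed.

Lemma powa0 : powa 0 = abundancy R.
Proof. by apply/funext => i; rewrite /powa expr0 mul1r. Qed.

Lemma F_mom y : 0 < y -> F y = mom 0 y.
Proof. by move=> y0; rewrite F_Lser// /mom powa0. Qed.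

Lemma mom_shift j y : 0 < y ->
  expR (- y) * limn (pseries (pseries_diffs (powa j)) (expR (- y))) = mom j.+1 y.
Proof.
move=> y0; set r := expR (- y).
have rlt : `|r| < `|expR (- (y / 2))|.
  by rewrite !ger0_norm ?expR_ge0// ltr_expR ltrN2 ltr_pdivrMr//; lra.
have dc : cvgn (pseries (pseries_diffs (powa j)) r).
  by apply: is_cvg_pseries_diffs rlt; apply: is_cvg_powa; rewrite divr_gt0.
have pE : pseries_diffs (powa j) = powa j.+1 \o S.
  by apply/funext => i; rewrite /pseries_diffs /powa/= exprS mulrA.
apply/esym/cvg_lim => //; rewrite -cvg_shiftS.
under eq_fun do rewrite pseries_shift /powa exprS !mul0r add0r -/(powa j.+1) -pE.
by apply: cvgM dc; exact: cvg_cst.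
Qed.

Lemma is_derive_mom j y : 0 < y -> is_derive y 1 (mom j) (- mom j.+1 y).
Proof.
move=> y0.
have lt (c d : R) : 0 < d -> d < c -> `|expR (- (y / d))| < `|expR (- (y / c))|.
  move=> d0 dc; rewrite !ger0_norm ?expR_ge0// ltr_expR ltrN2 ltr_pM2l//.
  by rewrite ltf_pV2// posrE// (lt_trans d0).
have pos (d : R) : 0 < d -> 0 < y / d by move=> d0; rewrite divr_gt0.
(* The radius e^(-y/d) grows with d. Starting from y/4, each derived series converges at a smaller
   radius, down to y/2, which still exceeds e^(-y). *)
have c1 := @is_cvg_powa j _ (pos 2 (ltr0n R 2)).
have c4 := @is_cvg_powa j _ (pos 4 (ltr0n R 4)).
have d3 : cvgn (pseries (pseries_diffs (powa j)) (expR (- (y / 3)))).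
  by apply: is_cvg_pseries_diffs c4 _; apply: lt; lra.
have d2 : cvgn (pseries (pseries_diffs (powa j)) (expR (- (y / 2)))).
  by apply: is_cvg_pseries_inside d3 _; apply: lt; lra.
have e2 : cvgn (pseries (pseries_diffs (pseries_diffs (powa j))) (expR (- (y / 2)))).
  by apply: is_cvg_pseries_diffs d3 _; apply: lt; lra.
have lt1 : `|expR (- y)| < `|expR (- (y / 2))|.
  by rewrite -{1}[y]divr1; apply: lt; lra.
have dL := pseries_snd_diffs c1 d2 e2 lt1.
have dE : is_derive y 1 (fun y : R => expR (- y)) (- expR (- y)).
  by apply: is_derive_eq; rewrite /GRing.scale/=; ring.
have := @is_derive1_comp _ (fun x => limn (pseries (powa j) x)) (fun y : R => expR (- y))
  y _ _ dL dE.
by rewrite mulrN mulrC mom_shift.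
Qed.

Lemma derive1_F y : 0 < y -> derive1 (@F R) y = - mom 1 y.
Proof.
move=> y0; rewrite derive1E.
have near_eq : \forall x \near y, F x = mom 0 x.
  by near=> x; apply: F_mom; near: x; exact: lt_nbhsr.
rewrite (near_eq_derive _ near_eq).
exact: (@derive_val _ _ _ _ _ _ _ (is_derive_mom 0 y0)).
Unshelve. all: by end_near. Qed.

Lemma derive2_F y : 0 < y -> derive1n 2 (@F R) y = mom 2 y.
Proof.
move=> y0; rewrite /derive1n/= derive1E.
have near_eq : \forall x \near y, derive1 (@F R) x = - mom 1 x.
  by near=> x; apply: derive1_F; near: x; exact: lt_nbhsr.
rewrite (near_eq_derive _ near_eq).
have d := is_deriveN (is_derive_mom 1 y0).
by rewrite (@derive_val _ _ _ _ _ _ _ d) opprK.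
Unshelve. all: by end_near. Qed.

End moments.

Lemma sum_expr_mul1B (S : comNzRingType) (x : S) (M : nat) :
  (\sum_(1 <= i < M.+1) x ^+ i) * (1 - x) = x - x ^+ M.+1.
Proof.
elim: M => [|M IHM]; first by rewrite big_geq// mul0r expr1 subrr.
by rewrite big_nat_recr//= mulrDl IHM [x ^+ M.+2]exprS; ring.
Qed.

(** * Truncated tilted laws and the decay of their characteristic functions *)

Section tilted_polynomials.
Variable R : realType.
Implicit Types (y t : R) (M : nat).

(** The law of X cut at M and not renormalised, so that the low coefficients of its powers are
    exact. *)
Definition tilt y M : {poly R} :=
  \poly_(m < M.+1) (abundancy R m * expR (- y) ^+ m / F y).

Lemma F_ge_geometric y : 0 < y -> expR (- y) / (1 - expR (- y)) <= F y.
Proof.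
move=> y0; set r := expR (- y); have r01 : 0 < r < 1 by exact: expRN_itv.
have /andP[r0 r1] := r01; have r1' : 0 < 1 - r by rewrite subr_gt0.
have lim : (r - r ^+ N.+1) / (1 - r) @[N --> \oo] --> r / (1 - r).
  apply: cvgM; last exact: cvg_cst.
  rewrite -[X in _ --> X]subr0; apply: cvgB; first exact: cvg_cst.
  by rewrite (cvg_shiftS (fun n => r ^+ n)); apply: cvg_expr; rewrite gtr0_norm.
rewrite -(cvg_lim _ lim)//; apply: limr_le; first exact: cvgP lim.
apply: nearW => N; rewrite F_Lser// -/r.
apply: le_trans (pseries_abundancy_le_Lser N.+1 r01); rewrite pseries_abundancyE.
rewrite -sum_expr_mul1B mulfK ?gt_eqF//.
apply: ler_sum_nat => i /andP[i1 _].
by rewrite ler_peMl ?exprn_ge0 ?(ltW r0)//; exact: divsum_inv_ge1.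
Qed.

Lemma F_gt0 y : 0 < y -> 0 < F y.
Proof.
move=> y0; apply: lt_le_trans (F_ge_geometric y0).
by have /andP[r0 r1] := expRN_itv y0; rewrite divr_gt0// subr_gt0.
Qed.

Lemma coef_tilt_ge0 y M i : 0 < y -> 0 <= (tilt y M)`_i.
Proof.
move=> y0; rewrite coef_poly; case: ifP => // _.
by rewrite divr_ge0 ?mulr_ge0 ?abundancy_ge0 ?exprn_ge0 ?expR_ge0// ltW// F_gt0.
Qed.

Lemma sum_tilt (V : lmodType R) y M (h : nat -> V) :
  \sum_(i < size (tilt y M)) (tilt y M)`_i *: h i =
  \sum_(0 <= i < M.+1) (abundancy R i * expR (- y) ^+ i / F y) *: h i.
Proof.
rewrite -(big_mkord xpredT (fun i => (tilt y M)`_i *: h i)).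
have sM : (size (tilt y M) <= M.+1)%N by exact: size_poly.
transitivity (\sum_(0 <= i < M.+1) (tilt y M)`_i *: h i).
  rewrite [RHS](big_cat_nat (n := size (tilt y M)))//=.
  have tail : \sum_(size (tilt y M) <= i < M.+1) (tilt y M)`_i *: h i = 0.
    by rewrite big_nat big1// => i /andP[si _]; rewrite nth_default// scale0r.
  by rewrite tail addr0.
by apply: eq_big_nat => i /andP[_ iM]; rewrite coef_poly iM.
Qed.

Lemma sum_tilt_pow y M j : \sum_(i < size (tilt y M)) (tilt y M)`_i * i%:R ^+ j =
  pseries (powa R j) (expR (- y)) M.+1 / F y.
Proof.
have := sum_tilt y M (fun i => i%:R ^+ j : R^o); rewrite /GRing.scale/= => ->.
rewrite /pseries /series/= mulr_suml; apply: eq_bigr => i _.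
by rewrite /powa; ring.
Qed.

Lemma sum_tilt_le1 y M : 0 < y -> \sum_(i < size (tilt y M)) (tilt y M)`_i <= 1.
Proof.
move=> y0; have := sum_tilt_pow y M 0; under eq_bigr do rewrite expr0 mulr1.
move=> ->; rewrite ler_pdivrMr ?F_gt0// mul1r F_mom//.
exact: pseries_powa_le_mom.
Qed.

Lemma cvg_sum_tilt_pow y j : 0 < y ->
  \sum_(i < size (tilt y M)) (tilt y M)`_i * i%:R ^+ j @[M --> \oo] --> mom j y / F y.
Proof.
move=> y0; under eq_fun do rewrite sum_tilt_pow.
apply: cvgM; last exact: cvg_cst.
by rewrite cvg_shiftS; exact: is_cvg_powa.
Qed.

Definition mean y : R := mom 1 y / F y.
Definition variance y : R := mom 2 y / F y - mean y ^+ 2.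

Lemma cvg_sum_tilt y : 0 < y ->
  \sum_(i < size (tilt y M)) (tilt y M)`_i @[M --> \oo] --> (1 : R).
Proof.
move=> y0; have := cvg_sum_tilt_pow (j := 0) y0; rewrite -F_mom// divff ?gt_eqF ?F_gt0//.
by under eq_fun do under eq_bigr do rewrite expr0 mulr1.
Qed.

Lemma cvg_sum_tilt_centered y : 0 < y ->
  \sum_(i < size (tilt y M)) (tilt y M)`_i * (i%:R - mean y) @[M --> \oo] --> (0 : R).
Proof.
move=> y0.
have -> : (fun M => \sum_(i < size (tilt y M)) (tilt y M)`_i * (i%:R - mean y)) =
    (fun M => \sum_(i < size (tilt y M)) (tilt y M)`_i * i%:R ^+ 1 -
      mean y * \sum_(i < size (tilt y M)) (tilt y M)`_i).
  apply/funext => M; rewrite mulr_sumr -sumrB; apply: eq_bigr => i _.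
  by rewrite expr1; ring.
rewrite -[X in _ --> X](subrr (mean y)) -[X in _ --> _ - X]mulr1.
apply: cvgB; first exact: cvg_sum_tilt_pow.
by apply: cvgM; [exact: cvg_cst|exact: cvg_sum_tilt].
Qed.

Lemma cvg_sum_tilt_centered_sqr y : 0 < y ->
  \sum_(i < size (tilt y M)) (tilt y M)`_i * (i%:R - mean y) ^+ 2 @[M --> \oo] -->
  variance y.
Proof.
move=> y0.
have -> : (fun M => \sum_(i < size (tilt y M)) (tilt y M)`_i * (i%:R - mean y) ^+ 2) =
    (fun M => \sum_(i < size (tilt y M)) (tilt y M)`_i * i%:R ^+ 2 -
      2 * mean y * (\sum_(i < size (tilt y M)) (tilt y M)`_i * i%:R ^+ 1) +
      mean y ^+ 2 * \sum_(i < size (tilt y M)) (tilt y M)`_i).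
  apply/funext => M; rewrite !mulr_sumr -sumrB -big_split; apply: eq_bigr => i _ /=.
  by rewrite expr1; ring.
have -> : variance y = mom 2 y / F y - 2 * mean y * (mom 1 y / F y) + mean y ^+ 2 * 1.
  by rewrite /variance -/(mean y); ring.
apply: cvgD; first apply: cvgB; first exact: cvg_sum_tilt_pow.
  by apply: cvgM; [exact: cvg_cst|exact: cvg_sum_tilt_pow].
by apply: cvgM; [exact: cvg_cst|exact: cvg_sum_tilt].
Qed.

(** From 1 - cos x = 2 sin^2(x/2) and sin h >= h - h^3/6 >= h/3 for 0 <= h <= 2, a range that
    contains pi/2. *)
Lemma oneBcos_ge t : `|t| <= pi -> t ^+ 2 / 18 <= 1 - cos t.
Proof.
move=> tpi; rewrite -cos_norm -(real_normK (num_real t)).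
have := normr_ge0 t; move: tpi; move: `|t| => x xpi x0.
have x2 : x / 2 <= 2.
  by have := @pihalf_lt2 R; have := xpi; lra.
have h0 : 0 <= x / 2 by rewrite divr_ge0.
have s1 : (x / 2) / 3 <= sin (x / 2).
  apply: le_trans (sin_ge_cubic h0).
  have : (x / 2) ^+ 2 <= 2 ^+ 2 by rewrite lerXn2r ?nnegrE.
  by move=> /(ler_wpM2l h0); rewrite [(x / 2) ^+ 3]exprS; lra.
have -> : cos x = 1 - 2 * sin (x / 2) ^+ 2.
  have {1}-> : x = (x / 2) *+ 2 by rewrite -mulr_natr; field.
  by rewrite cos_mulr2n cos2sin2 -mulr_natl; ring.
have s2 : (x / 2 / 3) ^+ 2 <= sin (x / 2) ^+ 2.
  by rewrite lerXn2r ?nnegrE ?divr_ge0// (le_trans _ s1)// divr_ge0.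
by move: s2; rewrite (_ : (x / 2 / 3) ^+ 2 = x ^+ 2 / 36); [lra|field].
Qed.

Lemma normc_1B_cis (r t : R) :
  normc (1 - (r%:C)%C * cis t) ^+ 2 = (1 - r) ^+ 2 + 2 * r * (1 - cos t).
Proof.
have -> : 1 - (r%:C)%C * cis t = Complex (1 - r * cos t) (- (r * sin t)).
  by apply/eqP; rewrite eq_complex/=; apply/andP; split; apply/eqP; ring.
rewrite normc_sqr/= sqrrN [(r * sin t) ^+ 2]exprMn sin2cos2; ring.
Qed.

Lemma normc_charf_tilt y mu t M :
  normc (charf (tilt y M) mu t) =
  normc (\sum_(0 <= i < M.+1) (abundancy R i * expR (- y) ^+ i / F y)%:C%C * cis t ^+ i).
Proof.
have -> : charf (tilt y M) mu t = cis (- (mu * t)) *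
    \sum_(0 <= i < M.+1) (abundancy R i * expR (- y) ^+ i / F y)%:C%C * cis t ^+ i.
  rewrite charfE; congr (_ * _).
  rewrite (@horner_coef_wide _ M.+1); last first.
    rewrite size_map_inj_poly//; [exact: size_poly|exact: complexI].
  rewrite big_mkord; apply: eq_bigr => i _.
  by rewrite coef_map/= coef_poly ltn_ord.
by rewrite normcM normc_cis mul1r.
Qed.

(* The coefficients dominate those of the geometric series, which carries at least half of
   the total mass; so the cancellation in the geometric part is felt by the whole sum. *)
Lemma normc_charf_tilt_le (Y y mu t : R) M : 0 < y <= Y -> `|t| <= pi ->
  normc (charf (tilt y M) mu t) <=
  1 - (expR (- Y) / 9 * t ^+ 2) / (y ^+ 2 + expR (- Y) / 9 * t ^+ 2) / 4
  + 2 * expR (- y) ^+ M.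
Proof.
move=> /andP[y0 yY] tpi; rewrite normc_charf_tilt.
(* Origin of c: 2 r (1 - cos t) >= 2 e^(-Y) t^2/18. *)
set r := expR (- y); set c := expR (- Y) / 9.
have r01 : 0 < r < 1 by exact: expRN_itv.
have /andP[r0 r1] := r01; have r1' : 0 < 1 - r by rewrite subr_gt0.
have F0 := F_gt0 y0; have Fg := F_ge_geometric y0; rewrite -/r in Fg.
pose D := normc (1 - (r%:C)%C * cis t).
have c0 : 0 < c by rewrite divr_gt0// expR_gt0.
have a0 : 0 <= c * t ^+ 2 by rewrite mulr_ge0 ?sqr_ge0// ltW.
have D2 : D ^+ 2 = (1 - r) ^+ 2 + 2 * r * (1 - cos t) by exact: normc_1B_cis.
have D0 : 0 <= D by exact: normc_ge0.
have cos1 : 0 <= 2 * r * (1 - cos t) by rewrite !mulr_ge0 ?(ltW r0)// subr_ge0 cos_le1.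
have Dr : 1 - r <= D.
  rewrite -(@ler_pXn2r _ 2)// ?nnegrE ?(ltW r1')//.
  by rewrite D2 lerDl.
have Dgt0 : 0 < D by exact: lt_le_trans Dr.
(* For g = (1 - r)/D in [0, 1] one has 1 - g >= (1 - g^2)/2, and g^2 is rational in r and cos t
   whereas D is a square root. *)
have gain : c * t ^+ 2 / (y ^+ 2 + c * t ^+ 2) / 2 <= 1 - (1 - r) / D.
  pose g := (1 - r) / D.
  have g0 : 0 <= g by rewrite divr_ge0// ltW.
  have g1 : g <= 1 by rewrite ler_pdivrMr// mul1r.
  apply: (@le_trans _ _ ((1 - g ^+ 2) / 2)); last first.
    have := mulr_ge0 g0 (_ : 0 <= 1 - g); rewrite subr_ge0 => /(_ g1).
    rewrite -/g (_ : g * (1 - g) = g - g ^+ 2); last by ring.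
    have : 0 <= (1 - g) ^+ 2 by rewrite sqr_ge0.
    by rewrite (_ : (1 - g) ^+ 2 = 1 - 2 * g + g ^+ 2); [lra|ring].
  apply: ler_wpM2r => //.
  have -> : 1 - g ^+ 2 = 2 * r * (1 - cos t) / D ^+ 2.
    rewrite /g exprMn exprVn; apply: (mulIf (lt0r_neq0 (exprn_gt0 2 Dgt0))).
    by rewrite divfK ?gt_eqF ?exprn_gt0// mulrBl divfK ?gt_eqF ?exprn_gt0// D2; ring.
  have ge1 : c * t ^+ 2 <= 2 * r * (1 - cos t).
    have rY : expR (- Y) <= r by rewrite ler_expR lerN2.
    have := oneBcos_ge tpi => H.
    have h1 := ler_wpM2l (ltW r0) H.
    have h2 := ler_wpM2r (sqr_ge0 t) rY.
    by rewrite /c; lra.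
  have ge2 : (1 - r) ^+ 2 <= y ^+ 2.
    rewrite lerXn2r ?nnegrE ?(ltW r1') ?(ltW y0)//.
    by have := expR_ge1Dx (- y); rewrite -/r; lra.
  have yc : 0 < y ^+ 2 + c * t ^+ 2 by rewrite ltr_wpDr// exprn_gt0.
  rewrite ler_pdivrMr// [leRHS]mulrAC ler_pdivlMr ?exprn_gt0// D2.
  have h1 := ler_pM a0 (sqr_ge0 (1 - r)) ge1 ge2.
  by rewrite !mulrDr; move: h1; lra.
have geomE : (\sum_(1 <= i < M.+1) ((r%:C)%C * cis t) ^+ i) * (1 - (r%:C)%C * cis t) =
    (r%:C)%C * cis t - ((r%:C)%C * cis t) ^+ M.+1.
  exact: sum_expr_mul1B.
have geom : normc (\sum_(1 <= i < M.+1) ((r%:C)%C * cis t) ^+ i) <= (r + r ^+ M.+1) / D.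
  rewrite ler_pdivlMr// /D -normcM geomE (le_trans (le_normcD _ _))//.
  by rewrite normcN normcX normcM normc_real normc_cis mulr1 (gtr0_norm r0).
have rsum : \sum_(1 <= i < M.+1) r ^+ i = (r - r ^+ M.+1) / (1 - r).
  by rewrite -sum_expr_mul1B mulfK ?gt_eqF.
have splitE : \sum_(0 <= i < M.+1) (abundancy R i * r ^+ i / F y)%:C%C * cis t ^+ i =
    \sum_(1 <= i < M.+1) ((abundancy R i - 1) * r ^+ i / F y)%:C%C * cis t ^+ i +
    ((F y)^-1)%:C%C * \sum_(1 <= i < M.+1) ((r%:C)%C * cis t) ^+ i.
  rewrite big_ltn// abundancy0 !mul0r add0r mulr_sumr -big_split/=.
  apply: eq_bigr => i _; rewrite exprMn -rmorphXn/= mulrA -rmorphM/= -mulrDl -rmorphD/=.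
  by congr (_%:C%C * _); ring.
have sum_le : normc (\sum_(1 <= i < M.+1) ((abundancy R i - 1) * r ^+ i / F y)%:C%C * cis t ^+ i)
    <= 1 - (r - r ^+ M.+1) / (1 - r) / F y.
  rewrite (le_trans (normc_sum _ _ _))//.
  apply: (@le_trans _ _ (\sum_(1 <= i < M.+1) (abundancy R i * r ^+ i / F y - r ^+ i / F y))).
    apply: ler_sum_nat => i /andP[i1 _].
    rewrite normcM normc_real normcX normc_cis expr1n mulr1 ger0_norm.
      by rewrite mulrBl mul1r mulrBl.
    by rewrite divr_ge0 ?(ltW F0)// mulr_ge0 ?exprn_ge0 ?(ltW r0)// subr_ge0 divsum_inv_ge1.
  rewrite sumrB -!mulr_suml rsum lerB// ler_pdivrMr// mul1r -pseries_abundancyE F_Lser//.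
  exact: pseries_abundancy_le_Lser.
rewrite splitE (le_trans (le_normcD _ _))// normcM normc_real ger0_norm ?invr_ge0 ?(ltW F0)//.
have Fi0 : 0 <= (F y)^-1 by rewrite invr_ge0 ltW.
have := lerD sum_le (ler_wpM2l Fi0 geom); move=> /le_trans; apply.
(* The geometric part has at least half of the mass because F(y) <= 2 r/(1 - r), where 2 bounds the
   sum of 1/d^2. *)
have w2 : 1 / 2 <= r / (1 - r) / F y.
  rewrite ler_pdivlMr//.
  by have := Lser_le r01; rewrite -F_Lser//; lra.
have w1 : r / (1 - r) / F y <= 1 by rewrite ler_pdivrMr// mul1r.
have gain0 : 0 <= c * t ^+ 2 / (y ^+ 2 + c * t ^+ 2) / 2.
  by rewrite !divr_ge0// addr_ge0// sqr_ge0.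
have half0 : (0 : R) <= 1 / 2 by lra.
have h1 := ler_pM half0 gain0 w2 gain.
have rM0 : 0 <= r ^+ M by rewrite exprn_ge0// ltW.
have Dinv : (1 - r) / D <= 1 by rewrite ler_pdivrMr// mul1r.
have h2 := ler_wpM2l rM0 w1.
have h3 : r ^+ M * (r / (1 - r) / F y * ((1 - r) / D)) <= r ^+ M.
  rewrite ler_piMr// -[leRHS]mul1r ler_pM// ?divr_ge0 ?(ltW r0) ?(ltW r1') ?(ltW F0)//.
have -> : 1 - (r - r ^+ M.+1) / (1 - r) / F y + (F y)^-1 * ((r + r ^+ M.+1) / D) =
   1 - r / (1 - r) / F y * (1 - (1 - r) / D) + r ^+ M * (r / (1 - r) / F y)
     + r ^+ M * (r / (1 - r) / F y * ((1 - r) / D)).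
  by rewrite exprS; field; rewrite !gt_eqF.
by lra.
Qed.

End tilted_polynomials.

(** * Bounds uniform for 0 < y <= Y *)

Section uniform_bounds.
Variable R : realType.
Implicit Types (Y y : R).

Lemma ler_of_cvg (f g : nat -> R) (a b : R) : f n @[n --> \oo] --> a ->
  g n @[n --> \oo] --> b -> (forall n, f n <= g n) -> a <= b.
Proof.
move=> fa gb fg; rewrite -(cvg_lim _ fa)// -(cvg_lim _ gb)//.
by apply: ler_lim; [exact: cvgP fa|exact: cvgP gb|exact: nearW].
Qed.

(** The decay of phi forces spread: 1 - t^2 Var/2 <= Re phi(t) <= |phi(t)|, by cos x >= 1 - x^2/2,
    and |phi(t)| is bounded away from 1 by [normc_charf_tilt_le]. The truncation errors vanish as M
    -> oo. *)
Lemma variance_ge Y y : 0 < y <= Y -> expR (- Y) / 36 / y ^+ 2 <= variance y.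
Proof.
move=> yY; have /andP[y0 _] := yY.
(* With t <= y the gain is at least c t^2/(2 y^2), so t^2 cancels; the cap 1 keeps t below pi. *)
pose t := Num.min y 1.
have t0 : 0 < t by rewrite lt_min y0 ltr01.
have ty : t <= y by rewrite ge_min lexx.
have t1 : t <= 1 by rewrite ge_min lexx orbT.
have tpi : `|t| <= pi by rewrite gtr0_norm// (le_trans t1)// (le_trans _ (pi_ge2 R))// ler1n.
have r01 := expRN_itv y0; have /andP[r0 r1] := r01.
pose c : R := expR (- Y) / 9.
have c0 : 0 < c by rewrite divr_gt0// expR_gt0.
have c1 : c <= 1.
  have : expR (- Y) <= 1 by rewrite -[leRHS]expR0 ler_expR oppr_le0 (le_trans (ltW y0))//; case/andP: yY.
  by rewrite /c; lra.
pose G := c * t ^+ 2 / (y ^+ 2 + c * t ^+ 2).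
have key : 1 - t ^+ 2 / 2 * variance y <= 1 - G / 4.
  apply: (@ler_of_cvg (fun M => \sum_(i < size (tilt y M)) (tilt y M)`_i -
     t ^+ 2 / 2 * \sum_(i < size (tilt y M)) (tilt y M)`_i * (i%:R - mean y) ^+ 2)
     (fun M => 1 - G / 4 + 2 * expR (- y) ^+ M)).
  - apply: cvgB; first exact: cvg_sum_tilt.
    by apply: cvgM; [exact: cvg_cst|exact: cvg_sum_tilt_centered_sqr].
  - rewrite -[X in _ --> X]addr0; apply: cvgD; first exact: cvg_cst.
    rewrite -[X in _ --> X](mulr0 2); apply: cvgM; first exact: cvg_cst.
    by apply: cvg_expr; rewrite gtr0_norm.
  - move=> M; apply: le_trans (normc_charf_tilt_le (mean y) M yY tpi).
    apply: le_trans (Re_le_normc _); apply: le_trans (ler_norm _).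
    rewrite Re_charf mulr_sumr -sumrB; apply: ler_sum => i _.
    have := ler_wpM2l (coef_tilt_ge0 M i y0) (cos_ge_quad ((i%:R - mean y) * t)).
    by apply: le_trans; rewrite le_eqVlt; apply/orP; left; apply/eqP; field.
have t20 : 0 < t ^+ 2 by rewrite exprn_gt0.
have ct2 : c * t ^+ 2 <= y ^+ 2.
  rewrite -[leRHS]mul1r; apply: ler_pM; rewrite ?(ltW c0) ?(ltW t20)//.
  by rewrite lerXn2r ?nnegrE ?(ltW t0) ?(ltW y0).
have G1 : c * t ^+ 2 / (2 * y ^+ 2) <= G.
  apply: ler_wpM2l; first by rewrite mulr_ge0 ?(ltW c0) ?(ltW t20).
  have y20 : 0 < y ^+ 2 by rewrite exprn_gt0.
  have p1 : 0 < y ^+ 2 + c * t ^+ 2 by rewrite addr_gt0// mulr_gt0.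
  have p2 : 0 < 2 * y ^+ 2 by rewrite mulr_gt0.
  by rewrite lef_pV2//; have := ct2; lra.
have : c * t ^+ 2 / (2 * y ^+ 2) / 2 <= t ^+ 2 * variance y.
  by have := key; have := G1; lra.
have -> : c * t ^+ 2 / (2 * y ^+ 2) / 2 = t ^+ 2 * (expR (- Y) / 36 / y ^+ 2).
  by rewrite /c; field; rewrite gt_eqF.
by rewrite ler_pM2l.
Qed.

(** The total mass F(y) is itself of order 1/y, which cancels the extra 1/y in [mom_le]. *)
Lemma momF_le Y y j : 0 < y <= Y ->
  mom j y / F y <= (j`!%:R * 2 ^+ j * 4 * expR Y) / y ^+ j.
Proof.
move=> yY; have /andP[y0 _] := yY.
have F1 : expR (- Y) / y <= F y.
  exact: le_trans (geometric_ratio_ge yY) (F_ge_geometric y0).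
have e0 : 0 < expR (- Y) / y by rewrite divr_gt0// expR_gt0.
have b0 : 0 <= (j`!%:R * 2 ^+ j * 4 * expR Y) / y ^+ j.
  by rewrite divr_ge0 ?exprn_ge0 ?(ltW y0)// !mulr_ge0 ?exprn_ge0 ?expR_ge0.
rewrite ler_pdivrMr ?F_gt0//.
apply: le_trans (ler_wpM2l b0 F1); apply: le_trans (mom_le j y0) _.
rewrite expRN le_eqVlt; apply/orP; left; apply/eqP; rewrite exprMn exprVn; field.
by rewrite !gt_eqF ?expR_gt0// exprn_gt0.
Qed.

Lemma mean_ge0 y : 0 < y -> 0 <= mean y.
Proof.
move=> y0; rewrite divr_ge0 ?(ltW (F_gt0 y0))//.
apply: le_trans (pseries_powa_le_mom 1 0 y0).
by rewrite /pseries /series/= big_geq.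
Qed.

Lemma mean_le Y y : 0 < y <= Y -> mean y <= 8 * expR Y / y.
Proof.
move=> /(momF_le 1); rewrite -/(mean y) => /le_trans; apply.
by rewrite (_ : 1`! = 1)%N// !expr1; lra.
Qed.

Lemma variance_le Y y : 0 < y <= Y -> variance y <= 32 * expR Y / y ^+ 2.
Proof.
move=> yY; apply: (@le_trans _ _ (mom 2 y / F y)).
  by rewrite /variance lerBlDr lerDl sqr_ge0.
apply: le_trans (momF_le 2 yY) _.
by rewrite le_eqVlt; apply/orP; left; apply/eqP; congr (_ / _); rewrite (_ : 2`! = 2)%N//; ring.
Qed.

(** For nonnegative i and mean m, |i - m|^3 <= i^3 + m^3. The constant 192 is 3! 2^3 4, and 8 comes
    from [mean_le]. *)
Lemma sum_tilt_abs3_le Y y M : 0 < y <= Y ->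
  \sum_(i < size (tilt y M)) (tilt y M)`_i * `|i%:R - mean y| ^+ 3 <=
  (192 * expR Y + (8 * expR Y) ^+ 3) / y ^+ 3.
Proof.
move=> yY; have /andP[y0 _] := yY; have m0 := mean_ge0 y0.
apply: (@le_trans _ _ (\sum_(i < size (tilt y M))
    ((tilt y M)`_i * i%:R ^+ 3 + (tilt y M)`_i * mean y ^+ 3))).
  apply: ler_sum => i _; rewrite -mulrDr; apply: ler_wpM2l; first exact: coef_tilt_ge0.
  have i0 : 0 <= i%:R :> R by [].
  have [im|mi] := leP (mean y) i%:R.
    rewrite ger0_norm ?subr_ge0//; apply: ler_wpDr; first exact: exprn_ge0.
    by rewrite lerXn2r ?nnegrE ?subr_ge0// lerBlDr lerDl.
  rewrite ler0_norm ?subr_le0 ?(ltW mi)// opprB; apply: ler_wpDl; first exact: exprn_ge0.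
  by rewrite lerXn2r ?nnegrE ?subr_ge0 ?(ltW mi)// lerBlDr lerDl.
rewrite big_split/= -mulr_suml mulrDl; apply: lerD.
  rewrite sum_tilt_pow.
  apply: (@le_trans _ _ (mom 3 y / F y)).
    apply: ler_wpM2r; first by rewrite invr_ge0 ltW// F_gt0.
    exact: pseries_powa_le_mom.
  apply: le_trans (momF_le 3 yY) _.
  by rewrite le_eqVlt; apply/orP; left; apply/eqP; congr (_ / _); rewrite (_ : 3`! = 6)%N//; ring.
apply: (@le_trans _ _ (1 * mean y ^+ 3)).
  by apply: ler_wpM2r; [exact: exprn_ge0|exact: sum_tilt_le1].
rewrite mul1r -exprVn -exprMn; have b0 : 0 <= 8 * expR Y / y.
  by rewrite divr_ge0 ?(ltW y0)// mulr_ge0// expR_ge0.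
by rewrite lerXn2r ?nnegrE//; exact: mean_le.
Qed.

(** Squaring the weights doubles y in the exponential, so the mean square bound gives 9/(2 y), while
    1/F(y)^2 is at most (e^Y y)^2. *)
Lemma sum_tilt_sqr_le Y y M : 0 < y <= Y ->
  \sum_(i < size (tilt y M)) (tilt y M)`_i ^+ 2 <= 9 / 2 * expR Y ^+ 2 * y.
Proof.
move=> yY; have /andP[y0 _] := yY.
have y20 : 0 < y * 2 by rewrite mulr_gt0.
have F1 : expR (- Y) / y <= F y.
  exact: le_trans (geometric_ratio_ge yY) (F_ge_geometric y0).
have e0 : 0 < expR (- Y) / y by rewrite divr_gt0// expR_gt0.
have FV : (F y)^-1 <= expR Y * y.
  have -> : expR Y * y = (expR (- Y) / y)^-1.
    by rewrite expRN; field; rewrite !gt_eqF ?expR_gt0.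
  by rewrite lef_pV2 ?posrE ?F_gt0.
have := sum_tilt y M (fun i => (tilt y M)`_i : R^o); rewrite /GRing.scale/=.
under eq_bigr do rewrite -expr2; move=> ->.
have -> : \sum_(0 <= i < M.+1) abundancy R i * expR (- y) ^+ i / F y * (tilt y M)`_i =
  (F y)^-1 ^+ 2 * \sum_(1 <= i < M.+1) abundancy R i ^+ 2 * expR (- (y * 2)) ^+ i.
  rewrite big_ltn// abundancy0 !mul0r add0r mulr_sumr; apply: eq_big_nat => i /andP[_ iM].
  rewrite coef_poly iM -mulNr expRM_natr -exprM mulnC exprM.
  by field; rewrite gt_eqF// F_gt0.
have S1 := sum_divsum_sqr_le M (expRN_itv y20).
have S2 := geometric_ratio_le y20.
apply: (@le_trans _ _ ((expR Y * y) ^+ 2 * (9 * (y * 2)^-1))).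
  apply: ler_pM.
  - by rewrite sqr_ge0.
  - by apply: sumr_ge0 => i _; rewrite mulr_ge0 ?sqr_ge0// exprn_ge0// expR_ge0.
  - by rewrite lerXn2r ?nnegrE ?invr_ge0 ?mulr_ge0 ?expR_ge0 ?(ltW y0) ?(ltW (F_gt0 y0)).
  - by apply: le_trans S1 _; have := S2; lra.
by rewrite le_eqVlt; apply/orP; left; apply/eqP; field; rewrite gt_eqF.
Qed.

(** In [mom 1 y - mom 0 y] the term i = 1 cancels. For i >= 2, e^(-iy) <= e^(-2(y-1)) e^(-i), and
    dividing by F(y) >= e^(-y) leaves e^(2-y). *)
Lemma mean_le_exp y : 1 <= y -> mean y - 1 <= expR (2 - y) * mom 1 (1 : R).
Proof.
move=> y1; have y0 : 0 < y by exact: lt_le_trans y1.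
have F0 := F_gt0 y0.
have Fe : expR (- y) <= F y.
  apply: le_trans (F_ge_geometric y0); have /andP[r0 r1] := expRN_itv y0.
  by rewrite ler_peMr ?(ltW r0)// invf_ge1 ?subr_gt0//; lra.
have m0 : 0 <= mom 1 (1 : R).
  apply: le_trans (pseries_powa_le_mom 1 0 ltr01).
  by rewrite /pseries /series/= big_geq.
have key : mom 1 y - mom 0 y <= expR (- (2 * (y - 1))) * mom 1 (1 : R).
  apply: (@ler_of_cvg (fun N => pseries (powa R 1) (expR (- y)) N - pseries (powa R 0) (expR (- y)) N)
    (fun N => expR (- (2 * (y - 1))) * pseries (powa R 1) (expR (- 1)) N)).
  - by apply: cvgB; exact: is_cvg_powa.
  - by apply: cvgM; [exact: cvg_cst|exact: is_cvg_powa].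
  - move=> N; rewrite /pseries /series/= -sumrB mulr_sumr; apply: ler_sum => i _.
    rewrite /powa expr1 expr0 mul1r.
    case: i => [|[|i]].
    + by rewrite !abundancy0 !mulr0 !mul0r subrr mulr0.
    + by rewrite mul1r subrr !mulr_ge0 ?abundancy_ge0 ?expR_ge0 ?exprn_ge0.
    + rewrite -mulrBl -[leRHS]mulrCA.
      apply: ler_pM; rewrite ?exprn_ge0 ?expR_ge0//.
      * by rewrite subr_ge0 ler_peMl ?abundancy_ge0// ler1n.
      * by rewrite lerBlDr lerDl abundancy_ge0.
      * rewrite -!expRM_natl -expRD ler_expR.
        have i2 : (2 : R) <= i.+2%:R by rewrite ler_nat.
        have := ler_wpM2r (_ : 0 <= y - 1) i2; rewrite subr_ge0 => /(_ y1); lra.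
rewrite /mean F_mom// -[X in _ - X](divff (x := mom 0 y)); last by rewrite -F_mom// gt_eqF.
rewrite -mulrBl -F_mom// ler_pdivrMr// F_mom//.
apply: le_trans key _; rewrite -F_mom//.
apply: (@le_trans _ _ (expR (2 - y) * mom 1 (1 : R) * expR (- y))).
  rewrite mulrAC -expRD; apply: ler_wpM2r => //; rewrite ler_expR; lra.
by apply: ler_wpM2l => //; rewrite mulr_ge0// expR_ge0.
Qed.

End uniform_bounds.

(** * The saddle point asymptotics *)

Section saddle_point.
Variable R : realType.
Implicit Types (Y y : R).

Lemma coef_exp_tilt y M n k : (n <= M)%N ->
  (tilt y M ^+ k)`_n = Lcoef R n k * expR (- y) ^+ n / F y ^+ k.
Proof.
move=> nM; rewrite -(Lpoly_exp_stable _ _ nM).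
elim: k n nM => [|k IHk] n nM.
  by rewrite !expr0 divr1 coef1; case: n {nM} => [|n]; rewrite ?mulr1 ?mul0r.
rewrite !exprS !coefM !mulr_suml; apply: eq_bigr => j _.
have jn : (j <= n)%N by rewrite -ltnS.
rewrite IHk ?(leq_trans (leq_subr _ _))// /tilt coef_poly coef_Lpoly !ltnS (leq_trans jn nM).
have -> : expR (- y) ^+ n = expR (- y) ^+ j * expR (- y) ^+ (n - j).
  by rewrite -exprD subnKC.
rewrite invfM; ring.
Qed.

Lemma tilt_truncation y (n k : nat) (eta : R) : 0 < y -> (0 < k)%N -> 0 < variance y ->
  0 < eta -> exists M, [/\ (n <= M)%N,
    `|\sum_(i < size (tilt y M)) (tilt y M)`_i - 1| <= (k%:R ^+ 2)^-1,
    `|\sum_(i < size (tilt y M)) (tilt y M)`_i * (i%:R - mean y)| <=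
      Num.sqrt (variance y) * (k%:R ^+ 2)^-1,
    `|\sum_(i < size (tilt y M)) (tilt y M)`_i * (i%:R - mean y) ^+ 2 - variance y| <=
      variance y * (k%:R ^+ 2)^-1 &
    2 * expR (- y) ^+ M <= eta].
Proof.
move=> y0 k0 v0 eta0.
have kV : 0 < (k%:R ^+ 2)^-1 :> R by rewrite invr_gt0 exprn_gt0// ltr0n.
have s0 : 0 < Num.sqrt (variance y) by rewrite sqrtr_gt0.
have r01 := expRN_itv y0; have /andP[r0 r1] := r01.
have rM : 2 * expR (- y) ^+ M @[M --> \oo] --> (0 : R).
  rewrite -[X in _ --> X](mulr0 2); apply: cvgM; first exact: cvg_cst.
  by apply: cvg_expr; rewrite gtr0_norm.
have near_ex (P : nat -> Prop) : (\forall M \near \oo, P M) -> exists M, P M.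
  by case=> M _ H; exists M; apply: H => /=.
apply: near_ex; near=> M; split.
- by near: M; exact: nbhs_infty_ge.
- by rewrite distrC; near: M; move/cvgrPdist_le: (cvg_sum_tilt y0); apply.
- rewrite -normrN -sub0r; near: M.
  by move/cvgrPdist_le: (cvg_sum_tilt_centered y0); apply; rewrite mulr_gt0.
- rewrite distrC; near: M.
  by move/cvgrPdist_le: (cvg_sum_tilt_centered_sqr y0); apply; rewrite mulr_gt0.
- apply: le_trans (ler_norm _) _; near: M.
  by move/cvgr0Pnorm_le: rM; apply.
Unshelve. all: by end_near. Qed.

(** Feeds the truncated laws to [cvg_local_limit]: s lies between s1/y and s2/y, and all constants
    depend on Y alone. *)
Lemma cvg_tilted_coef Y (n k : nat -> nat) (y : nat -> R) :
  k i @[i --> \oo] --> \oo -> (forall i, (2 <= k i)%N) ->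
  (forall i, 0 < y i <= Y) -> (forall i, (k i)%:R * mean (y i) = (n i)%:R) ->
  Num.sqrt (2 * pi * (k i)%:R * variance (y i)) *
    (Lcoef R (n i) (k i) * expR (- y i) ^+ n i / F (y i) ^+ k i) @[i --> \oo] --> (1 : R).
Proof.
move=> koo k2 yY kmean.
have y0 i : 0 < y i by case/andP: (yY i).
have Y0 : 0 < Y by case/andP: (yY 0%N) => ? ?; exact: lt_le_trans (y0 0%N) _.
have eY := expR_gt0 Y.
pose s i := Num.sqrt (variance (y i)).
pose s1 : R := Num.sqrt (expR (- Y) / 36); pose s2 : R := Num.sqrt (32 * expR Y).
have s10 : 0 < s1 by rewrite sqrtr_gt0 divr_gt0// expR_gt0.
have s20 : 0 < s2 by rewrite sqrtr_gt0 mulr_gt0.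
have sqrty i : y i = Num.sqrt (y i ^+ 2) by rewrite sqrtr_sqr gtr0_norm.
have v0 i : 0 < variance (y i).
  by apply: lt_le_trans (variance_ge (yY i)); rewrite !divr_gt0 ?expR_gt0 ?exprn_gt0.
have s2E i : s i ^+ 2 = variance (y i) by rewrite sqr_sqrtr// ltW.
have s0 i : 0 < s i by rewrite sqrtr_gt0.
have s_ge i : s1 / y i <= s i.
  have d0 : 0 <= s1 / y i by rewrite divr_ge0 ?(ltW s10) ?(ltW (y0 i)).
  rewrite -(@ler_pXn2r _ 2)// ?nnegrE ?(ltW (s0 i))//.
  rewrite s2E exprMn exprVn sqr_sqrtr; last by rewrite divr_ge0// expR_ge0.
  exact: variance_ge.
have s_le i : s i <= s2 / y i.
  have d0 : 0 <= s2 / y i by rewrite divr_ge0 ?(ltW s20) ?(ltW (y0 i)).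
  rewrite -(@ler_pXn2r _ 2)// ?nnegrE ?(ltW (s0 i))//.
  rewrite s2E exprMn exprVn sqr_sqrtr; last by rewrite mulr_ge0// expR_ge0.
  exact: variance_le.
pose T : R := 192 * expR Y + (8 * expR Y) ^+ 3.
have T0 : 0 <= T by rewrite addr_ge0 ?exprn_ge0 ?mulr_ge0 ?expR_ge0.
pose C : R := T / s1 ^+ 3 + 9 / 2 * expR Y ^+ 2 * s2.
have C1 : 0 <= T / s1 ^+ 3 by rewrite divr_ge0// exprn_ge0// ltW.
have C2 : 0 <= 9 / 2 * expR Y ^+ 2 * s2.
  by rewrite mulr_ge0 ?(ltW s20)// mulr_ge0 ?sqr_ge0// divr_ge0.
have C0 : 0 <= C by rewrite addr_ge0.
(* The first entry yields both rho <= 1 and 8 C rho <= 1; the second keeps the central window within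
   the period, s1/Y being a lower bound for s. *)
pose rho : R := Num.min (8 * C + 1)^-1 (pi * (s1 / Y)).
have s1Y : 0 < s1 / Y by rewrite divr_gt0.
have c1 : 1 <= 8 * C + 1 by have := C0; lra.
have c0 : 0 < 8 * C + 1 by rewrite (lt_le_trans _ c1).
have cV : rho <= (8 * C + 1)^-1 by rewrite ge_min lexx.
have rho0 : 0 < rho by rewrite lt_min invr_gt0 c0 mulr_gt0// pi_gt0.
have rho1 : rho <= 1 by rewrite (le_trans cV)// invf_le1.
have rhoC : 8 * C * rho <= 1.
  have C8 : 0 <= 8 * C by rewrite mulr_ge0.
  apply: (le_trans (ler_wpM2l C8 cV)).
  by rewrite ler_pdivrMr// mul1r; lra.
have rhos : rho <= pi * (s1 / Y) by rewrite ge_min lexx orbT.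
pose c : R := expR (- Y) / 9; have cpos : 0 < c by rewrite divr_gt0// expR_gt0.
(* If s |t| >= rho then c t^2 >= a y^2, so the loss in [normc_charf_tilt_le] is at least a/(1 + a)/4
   = 2 eta. Truncation gives back at most eta, leaving q = 1 - eta. *)
pose a := c * (rho / s2) ^+ 2; have a0 : 0 < a by rewrite mulr_gt0// exprn_gt0// divr_gt0.
have a1 : 0 < 1 + a by rewrite addr_gt0.
pose eta := a / (1 + a) / 8.
have eta0 : 0 < eta by rewrite !divr_gt0.
have eta1 : eta <= 1 / 8.
  rewrite /eta; apply: ler_wpM2r => //; rewrite ler_pdivrMr// mul1r; lra.
have [M MP] := choice (fun i => tilt_truncation (n i) (y0 i) (ltnW (k2 i)) (v0 i) eta0).
have lim : Num.sqrt (2 * pi) * (s i * Num.sqrt (k i)%:R) *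
    (tilt (y i) (M i) ^+ k i)`_(n i) @[i --> \oo] --> (1 : R).
  apply: (@cvg_local_limit R (fun i => tilt (y i) (M i)) k n (fun i => mean (y i)) s C (s1 / Y)
    rho (1 - eta) rho0 rho1 rhoC rhos _ koo k2 kmean s1Y _ C0).
  - by apply/andP; split; lra.
  - move=> i; apply: le_trans (s_ge i); apply: ler_wpM2l; first exact: ltW.
    by rewrite lef_pV2 ?posrE//; case/andP: (yY i).
  - by move=> i j; exact: coef_tilt_ge0.
  - by move=> i; exact: sum_tilt_le1.
  - by move=> i; case: (MP i).
  - by move=> i; case: (MP i).
  - by move=> i; rewrite s2E; case: (MP i).
  - move=> i; apply: le_trans (sum_tilt_abs3_le _ (yY i)) _; rewrite -/T.
    have -> : T / y i ^+ 3 = T / s1 ^+ 3 * (s1 / y i) ^+ 3.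
      by field; rewrite !gt_eqF.
    apply: ler_pM => //.
    + by rewrite exprn_ge0// divr_ge0 ?(ltW s10) ?(ltW (y0 i)).
    + by rewrite lerDl.
    + by rewrite lerXn2r ?nnegrE ?divr_ge0 ?(ltW s10) ?(ltW (y0 i)) ?(ltW (s0 i)).
  - move=> i; have H := sum_tilt_sqr_le (M i) (yY i).
    have sq0 : 0 <= \sum_(j < size (tilt (y i) (M i))) (tilt (y i) (M i))`_j ^+ 2.
      by apply: sumr_ge0 => j _; exact: sqr_ge0.
    apply: le_trans (ler_pM (ltW (s0 i)) sq0 (s_le i) H) _.
    have -> : s2 / y i * (9 / 2 * expR Y ^+ 2 * y i) = 9 / 2 * expR Y ^+ 2 * s2.
      by field; rewrite gt_eqF.
    by rewrite /C; lra.
  - move=> i t st tpi; have [_ _ _ _ rM] := MP i.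
    apply: le_trans (normc_charf_tilt_le (mean (y i)) (M i) (yY i) tpi) _.
    rewrite -/c; suff : a / (1 + a) <= c * t ^+ 2 / (y i ^+ 2 + c * t ^+ 2) by rewrite /eta in rM *; lra.
    have yi2 : 0 < y i ^+ 2 by rewrite exprn_gt0.
    have ct0 : 0 <= c * t ^+ 2 by rewrite mulr_ge0 ?sqr_ge0// ltW.
    have ty : (rho / s2) ^+ 2 * y i ^+ 2 <= t ^+ 2.
      rewrite -exprMn -[leRHS](real_normK (num_real t)).
      have d0 : 0 <= rho / s2 * y i by rewrite mulr_ge0 ?divr_ge0// ltW.
      rewrite lerXn2r ?nnegrE// mulrAC ler_pdivrMr//.
      have := s_le i; rewrite ler_pdivlMr// => /(ler_wpM2l (normr_ge0 t)).
      by have := ler_wpM2r (ltW (y0 i)) st; lra.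
    rewrite ler_pdivrMr// mulrAC ler_pdivlMr ?ltr_wpDr//.
    by have := ler_wpM2l (ltW cpos) ty; rewrite /a; lra.
apply: cvg_trans lim; apply: near_eq_cvg; apply: nearW => i.
have [nM _ _ _ _] := MP i.
rewrite coef_exp_tilt// /s -!sqrtrM ?mulr_ge0 ?pi_ge0//; last exact: ltW.
by congr (Num.sqrt _ * _); ring.
Qed.

End saddle_point.

Theorem theorem3p1 (R : realType) (A : nat -> nat -> R) (hA : is_dArcais2 A)
  (eps : R) (heps : 0 < eps) (k : nat -> nat)
  (hk : forall n : nat, (0 < n)%N -> (k n)%:R / n%:R < 1 - eps)
  (hkoo : k n @[n --> \oo] --> \oo)
  (y : nat -> R)
  (hy : forall n : nat, (0 < n)%N -> (0 < k n)%N ->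
     0 < y n /\
     - (derive1 (@F R) (y n) / F (y n)) = 1 / ((k n)%:R / n%:R)) :
  asymp_equiv
    (fun n => (k n)`!%:R * A n (k n) / n`!%:R)
    (fun n =>
       expR ((k n)%:R * ln (F (y n)) + n%:R * y n) /
       Num.sqrt (2 * pi * (k n)%:R *
         (derive1n 2 (@F R) (y n) / F (y n) - (derive1 (@F R) (y n) / F (y n)) ^+ 2))).
Proof.
(* The local limit theorem asks for k >= 2 at every index, so the sequences are shifted by n0. *)
have [n0 n00 hn0] : exists2 n0 : nat, (0 < n0)%N & forall n, (n0 <= n)%N -> (2 <= k n)%N.
  have /cvgnyPge/(_ 2%N) [N _ HN] := hkoo.
  by exists N.+1 => // n Nn; apply: HN; exact: ltnW.
have eps1 : 0 < 1 - eps.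
  by apply: le_lt_trans (hk 1%N isT); rewrite divr_ge0.
pose yi i := y (i + n0)%N; pose ki i := k (i + n0)%N; pose ni i := (i + n0)%N.
have ni0 i : (0 < ni i)%N by rewrite addn_gt0 n00 orbT.
have ki2 i : (2 <= ki i)%N by apply: hn0; rewrite leq_addl.
have ki0 i : (0 < ki i)%N by exact: ltnW (ki2 i).
have ki0' i : 0 < (ki i)%:R :> R by rewrite ltr0n.
have ni0' i : 0 < (ni i)%:R :> R by rewrite ltr0n.
have yi0 i : 0 < yi i by case: (hy _ (ni0 i) (ki0 i)).
have meanE i : mean (yi i) = (ni i)%:R / (ki i)%:R.
  have [_] := hy _ (ni0 i) (ki0 i); rewrite -/(yi i) derive1_F// mulNr opprK /mean => ->.
  by rewrite div1r invf_div.
have kin i : (ki i <= ni i)%N.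
  rewrite -(ler_nat R); have := hk _ (ni0 i); rewrite ltr_pdivrMr// => /ltW/le_trans; apply.
  by rewrite ler_piMl// lerBlDr lerDl ltW.
pose delta := (1 - eps)^-1 - 1.
have delta0 : 0 < delta by rewrite subr_gt0 invf_gt1// ltrBlDr ltrDl.
(* From delta <= E(X) - 1 <= e^(2-y) [mom 1 1], solved for y; the maximum with 1 covers the y to
   which [mean_le_exp] does not apply. *)
pose Y := Num.max 1 (ln (expR 2 * mom 1 (1 : R) / delta)).
have yY i : 0 < yi i <= Y.
  apply/andP; split; first exact: yi0.
  rewrite le_max; have [y1|y1] := leP (yi i) 1 => //=.
  have dm : delta <= expR (2 - yi i) * mom 1 (1 : R).
    apply: le_trans (mean_le_exp (ltW y1)); rewrite /delta lerD2r meanE.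
    have q0 : 0 < (ki i)%:R / (ni i)%:R :> R by rewrite divr_gt0.
    by rewrite -invf_div lef_pV2 ?posrE// (ltW (hk _ (ni0 i))).
  have m0 : 0 < mom 1 (1 : R).
    by rewrite -(pmulr_rgt0 _ (expR_gt0 (2 - yi i))) (lt_le_trans delta0).
  rewrite -ler_expR lnK ?posrE ?divr_gt0 ?mulr_gt0 ?expR_gt0// ler_pdivlMr//.
  have e0 := expR_gt0 (yi i).
  have := ler_wpM2l (ltW e0) dm; rewrite mulrA -expRD.
  by rewrite (_ : yi i + (2 - yi i) = 2); last by ring.
have kioo : ki i @[i --> \oo] --> \oo by rewrite (cvg_shiftn n0 k).
have kmean i : (ki i)%:R * mean (yi i) = (ni i)%:R.
  by rewrite meanE mulrC divfK// gt_eqF.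
have lim := cvg_tilted_coef kioo ki2 yY kmean.
rewrite /asymp_equiv -(cvg_shiftn n0).
apply: cvg_trans lim; apply: near_eq_cvg; apply: nearW => i.
rewrite /= -/(ni i) -/(yi i) -/(ki i) dArcais_coef//.
have F0 := F_gt0 (yi0 i).
have /= -> := derive2_F (yi0 i); rewrite derive1_F// mulNr sqrrN -/(mean (yi i)) -/(variance (yi i)).
rewrite expRD !expRM_natl lnK ?posrE// expRN exprVn.
rewrite invf_div; field.
by rewrite !expf_neq0 ?gt_eqF ?expR_gt0.
Qed.
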